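(* Let $G$ be a contact Carnot group and let $p=(x,z)\in G$ be such that $$|z|<\frac{\pi}{8}\left(\frac{2\alpha_1^2}{\alpha_k}-\alpha_k\right)\|x\|^2 .$$ Then there is only one geodesic from $p_0$ to $p$.
   Context: A contact Carnot group $G$ is a connected, simply connected Lie group of dimension $2n+1$ whose Lie algebra of left-invariant vector fields splits as $\mathfrak g=\mathfrak g_1\oplus\mathfrak g_2$ with $\dim\mathfrak g_2=1$, $[\mathfrak g_1,\mathfrak g_1]=\mathfrak g_2$, $[\mathfrak g_1,\mathfrak g_2]=[\mathfrak g_2,\mathfrak g_2]=0$, with a scalar product on $\mathfrak g_1$ having orthonormal basis $f_1,\dots,f_{2n}$. Fix a generator $f_0$ of $\mathfrak g_2$; then $[f_i,f_j]=A_{ij}f_0$ for a skew-symmetric matrix $A$, which is required to be non-degenerate. Exponential coordinates: $p=(x,z)\in\mathbb{R}^{2n}\times\mathbb{R}$ means $p=\exp_G(\sum_i x_if_i+zf_0)$; $p_0=(0,0)$ is the identity. $0<\alpha_1<\dots<\alpha_k$ are the distinct singular values of $A$ (so $\alpha_1$ is the smallest and $\alpha_k$ the largest). A horizontal curve is a Lipschitz curve $\gamma:[0,1]\to G$ with $\dot\gamma(t)\in\mathfrak g_1|_{\gamma(t)}$ for a.e. $t$; its energy is $J(\gamma)=\frac12\int_0^1\|\dot\gamma\|^2dt$. A geodesic is a non-constant horizontal curve $\gamma:[0,1]\to G$ that is locally energy minimizing (each $t$ has an interval around it on which $\gamma$ minimizes the energy between its endpoints). *)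

(* Defs.v *)
From HB Require Import structures.
From mathcomp Require Import all_boot all_order all_algebra.
From mathcomp Require Import all_classical all_reals all_analysis.

Set Implicit Arguments.
Unset Strict Implicit.
Unset Printing Implicit Defensive.

Import Order.TTheory GRing.Theory Num.Theory.
Import numFieldNormedType.Exports.

Local Open Scope classical_set_scope.
Local Open Scope ring_scope.

Definition singular_value (R : realType) (m : nat) (A : 'M[R]_m) (s : R) : Prop :=
  0 <= s /\ eigenvalue (A^T *m A) (s ^+ 2).

Section LieAlgebra.
Context {R : realType} {g : vectType R}.

Definition lie_bracket (br : g -> g -> g) : Prop :=
  [/\ forall Y, linear (br^~ Y),
      forall X, linear (br X),
      forall X, br X X = 0
    & forall X Y Z, br X (br Y Z) + br Y (br Z X) + br Z (br X Y) = 0].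

(* [U, V], the span of all brackets; by bilinearity bases of U and V suffice. *)
Definition bracketv (br : g -> g -> g) (U V : {vspace g}) : {vspace g} :=
  <<[seq br X Y | X <- vbasis U, Y <- vbasis V]>>%VS.

Definition scalar_product_on (U : {vspace g}) (dot : g -> g -> R) : Prop :=
  [/\ {in U & &, forall (X Y Z : g) (a : R),
         dot (a *: X + Y) Z = a * dot X Z + dot Y Z},
      {in U &, forall X Y, dot X Y = dot Y X}
    & {in U, forall X : g, X != 0 -> 0 < dot X X}].

End LieAlgebra.

(* The connected, simply connected Lie group of a nilpotent Lie algebra g is
   determined by g: exp : g -> G is a global diffeomorphism, and in step 2 the
   Baker-Campbell-Hausdorff formula reduces to the field cc_BCH. The manifold
   structure of G is the one transported from g by cc_exp. *)
Record contactCarnot (R : realType) (n : nat) := ContactCarnot {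
  cc_alg : vectType R;
  cc_br : cc_alg -> cc_alg -> cc_alg;
  cc_lie : lie_bracket cc_br;
  cc_dim : \dim {: cc_alg} = (2 * n).+1;
  cc_g1 : {vspace cc_alg};
  cc_g2 : {vspace cc_alg};
  cc_sum : (cc_g1 + cc_g2)%VS = fullv;
  cc_direct : directv (cc_g1 + cc_g2);
  cc_dim2 : \dim cc_g2 = 1;
  cc_br11 : bracketv cc_br cc_g1 cc_g1 = cc_g2;
  cc_br12 : bracketv cc_br cc_g1 cc_g2 = 0%VS;
  cc_br22 : bracketv cc_br cc_g2 cc_g2 = 0%VS;
  cc_dot : cc_alg -> cc_alg -> R;
  cc_dotP : scalar_product_on cc_g1 cc_dot;
  cc_f : (2 * n).-tuple cc_alg;
  cc_f_basis : basis_of cc_g1 cc_f;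
  cc_f_orthonormal : forall i j : 'I_(2 * n),
    cc_dot (tnth cc_f i) (tnth cc_f j) = (i == j)%:R;
  cc_f0 : cc_alg;
  cc_f0_gen : <[cc_f0]>%VS = cc_g2;
  cc_A : 'M[R]_(2 * n);
  cc_AE : forall i j, cc_br (tnth cc_f i) (tnth cc_f j) = cc_A i j *: cc_f0;
  cc_A_unit : cc_A \in unitmx;
  cc_grp :> groupType;
  cc_exp : cc_alg -> cc_grp;
  cc_log : cc_grp -> cc_alg;
  cc_expK : cancel cc_exp cc_log;
  cc_logK : cancel cc_log cc_exp;
  cc_BCH : forall X Y,
    (cc_exp X * cc_exp Y)%g = cc_exp (X + Y + 2^-1 *: cc_br X Y)
}.

Section Curves.
Context {R : realType} {n : nat} {G : contactCarnot R n}.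

Definition ecoords (x : 'rV[R]_(2 * n)) (z : R) : G :=
  cc_exp (\sum_i x 0 i *: tnth (cc_f G) i + z *: cc_f0 G).

(* Index ord0 is the coordinate z along f_0, index lift ord0 i the coordinate
   x_i along f_i. *)
Definition cc_frame : (2 * n).+1.-tuple (cc_alg G) := [tuple of cc_f0 G :: cc_f G].
Definition ecoord (i : 'I_(2 * n).+1) (p : G) : R := coord cc_frame i (cc_log p).

(* The curve t0 |-> gamma(t)^-1 gamma(t0) passes through the identity at t0 = t,
   where the differential of exp is the identity, so its derivative at t in
   exponential coordinates is the element of g whose left-invariant vector field
   takes the value gamma'(t) at the point gamma(t). *)
Definition left_translated (gamma : R -> G) (t : R) (i : 'I_(2 * n).+1) (t0 : R) : R :=
  ecoord i ((gamma t)^-1 * gamma t0)%g.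

Definition differentiable_at (gamma : R -> G) (t : R) : Prop :=
  forall i, derivable (left_translated gamma t i) t 1.

Definition velocity (gamma : R -> G) (t : R) : cc_alg G :=
  \sum_i derive1 (left_translated gamma t i) t *: tnth cc_frame i.

Definition horizontal (a b : R) (gamma : R -> G) : Prop :=
  (forall i, [lipschitz ecoord i (gamma t) | t in `[a, b]]) /\
  {ae lebesgue_measure, forall t : R, a <= t <= b ->
     differentiable_at gamma t /\ velocity gamma t \in cc_g1 G}.

Definition energy (a b : R) (gamma : R -> G) : \bar R :=
  ((2^-1)%:E * \int[lebesgue_measure]_(t in `[a, b])
     (cc_dot (velocity gamma t) (velocity gamma t))%:E)%E.

Definition energy_minimizing (a b : R) (gamma : R -> G) : Prop :=
  forall eta, horizontal a b eta -> eta a = gamma a -> eta b = gamma b ->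
    (energy a b gamma <= energy a b eta)%E.

Definition geodesic (gamma : R -> G) : Prop :=
  [/\ horizontal 0 1 gamma,
      exists2 t : R, 0 <= t <= 1 & gamma t <> gamma 0
    & forall t : R, 0 <= t <= 1 -> exists2 e : R, 0 < e &
        energy_minimizing (Num.max 0 (t - e)) (Num.min 1 (t + e)) gamma].

End Curves.

(* Main.v *)
(** In exponential coordinates a horizontal curve is a Lipschitz curve [x] in R^(2n) whose
    height is the swept area [z' = x A x' / 2], and its energy is that of [x].  Varying a
    local minimizer by two bumps in coordinate directions, and adjusting the second one so
    that the end height is kept, yields a Lagrange multiplier [lam] and the equation
    [x' = c + lam x A]; here [x'] has constant length because [A] is skew, which lets the
    multipliers of overlapping intervals be glued.  Conversely, every solution minimizes
    the energy on short intervals.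

    Decompose the velocity at time 1/2 along the eigenspaces of [A^T A], with components
    [v_j], and put [th_j = lam alpha_j].  Then the end point [x] has components
    [x_j = (2 sin (th_j / 2) / th_j) v_j], and
    [2 lam z = \sum_j |v_j|^2 (1 - sin th_j / th_j)].  If [|lam| alpha_k >= pi], the
    inequality [th - sin th >= (1 - cos th) min (th - pi/2, pi/2)] forces [|z|] to be at
    least the bound of the statement.  If [|lam| alpha_k <= pi], the end point determines
    the [v_j] from [lam], and
    [z = \sum_j alpha_j |x_j|^2 (th_j - sin th_j) / (4 (1 - cos th_j))] is a strictly
    increasing function of [lam] that reaches every value below the bound. *)
Require Import Defs.
From HB Require Import structures.
From mathcomp Require Import all_boot all_order all_algebra.
From mathcomp Require Import all_classical all_reals all_analysis measurable_realfun.
From mathcomp Require Import ring lra.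

Set Implicit Arguments.
Unset Strict Implicit.
Unset Printing Implicit Defensive.

Import Order.TTheory GRing.Theory Num.Theory.
Import numFieldNormedType.Exports.

Local Open Scope classical_set_scope.
Local Open Scope ring_scope.

(** * Lipschitz functions and their derivatives *)

Section RealDerivatives.
Context {R : realType}.
Implicit Types (f g : R -> R) (c t : R).

(** Horizontal curves are only Lipschitz: their derivatives exist almost everywhere and come with no
    Borel measurability. Every Lipschitz function is therefore paired with a bounded Borel
    derivative, and a small calculus of such pairs is used until the Euler-Lagrange equation makes
    the curve smooth.

    The multiplier argument fails only when no bump changes the end height to first order; since [A]
    is invertible, the curve is then constant on that interval.

    The velocity is decomposed at time 1/2 because the displacement is then the integral of the
    velocity over an interval symmetric about that time: the components rotated by [A] cancel by
    parity, and each [x_j] is a multiple of [v_j].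

    The constant comes from a comparison made separately in each eigenspace. Let [B] be the factor
    of [|x|^2] in the bound and [lam > 0]. If [lam alpha_k >= pi], then
    [alpha_j th_j = lam alpha_j^2] is at least [pi alpha_1^2 / alpha_k], and [alpha_j pi / 2] is at
    most [alpha_k pi / 2]; the difference of these two bounds is exactly [4 B]. The same comparison
    at [lam = pi / alpha_k] shows that all heights below the bound are reached. *)

Lemma is_derive_add f g t (df dg : R) :
  is_derive t 1 f df -> is_derive t 1 g dg ->
  is_derive t 1 (fun s => f s + g s) (df + dg).
Proof. by move=> hf hg; have := is_deriveD hf hg. Qed.

Lemma is_derive_opp f t (df : R) :
  is_derive t 1 f df -> is_derive t 1 (fun s => - f s) (- df).
Proof. by move=> hf; have := is_deriveN hf. Qed.

Lemma is_derive_mul f g t (df dg : R) :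
  is_derive t 1 f df -> is_derive t 1 g dg ->
  is_derive t 1 (fun s => f s * g s) (df * g t + f t * dg).
Proof.
move=> hf hg; have := is_deriveM hf hg.
by rewrite /GRing.scale/= addrC (mulrC (g t)).
Qed.

Lemma is_derive_scale c f t (df : R) :
  is_derive t 1 f df -> is_derive t 1 (fun s => c * f s) (c * df).
Proof.
move=> hf; have := is_derive_mul (is_derive_cst c t 1) hf.
by rewrite mul0r add0r.
Qed.

Lemma is_derive_bigsum (I : finType) (f : I -> R -> R) t (df : I -> R) :
  (forall i, is_derive t 1 (f i) (df i)) ->
  is_derive t 1 (fun s => \sum_i f i s) (\sum_i df i).
Proof.
move=> H; elim: (index_enum I) => [|i r IH].
  under eq_fun do rewrite big_nil; rewrite big_nil; exact: is_derive_cst.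
under eq_fun do rewrite big_cons; rewrite big_cons; exact: is_derive_add.
Qed.

End RealDerivatives.

Section LipschitzFunctions.
Context {R : realType}.
Implicit Types (f g h : R -> R) (a b c t : R).
Local Notation mu := (@lebesgue_measure R).

Definition lipschitz_with (K a b : R) f :=
  forall s t, a <= s <= b -> a <= t <= b -> `|f s - f t| <= K * `|s - t|.

Lemma lipschitz_withP f a b :
  [lipschitz f t | t in `[a, b]] <-> exists K, lipschitz_with K a b f.
Proof.
split.
  move=> [M [_ /(_ (M + 1))]]; rewrite ltrDl ltr01 => /(_ isT) H.
  exists (M + 1) => s t sab tab; have /= := H (s, t); apply.
  by split; rewrite /= in_itv.
move=> [K H]; exists K; split; first exact: num_real.
move=> M KM [s t] [] /=; rewrite !in_itv /= => sab tab.
by apply: (le_trans (H _ _ sab tab)); rewrite ler_wpM2r// ltW.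
Qed.

Definition bounded_measurable a b g :=
  measurable_fun `[a, b] g /\
  exists M, forall t, a <= t <= b -> `|g t| <= M.

(** The derivative is a separate datum because the pointwise one may fail to exist on a null set,
    whereas integration needs a function that is Borel and bounded on all of [[a, b]]. The two-sided
    derivative may depend on values outside the interval only at the end points, which form a null
    set. *)
Definition lipschitz_derivative a b f g :=
  [/\ exists K, lipschitz_with K a b f, bounded_measurable a b g
    & {ae mu, forall t, a <= t <= b -> is_derive t 1 f (g t)}].

Lemma ae_neq c : {ae mu, forall t, t != c}.
Proof.
exists [set c]; split; [exact: measurable_set1 | exact: lebesgue_measure_set1|].
by move=> t /= /negP; rewrite negbK => /eqP.
Qed.

Lemma ae_and (P Q : R -> Prop) :
  {ae mu, forall t, P t} -> {ae mu, forall t, Q t} ->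
  {ae mu, forall t, P t /\ Q t}.
Proof.
move=> p q; apply: (@filterI _ _ (ae_filter_ringOfSetsType mu) _ _ p q).
Qed.

Lemma ae_imply (P Q : R -> Prop) : (forall t, P t -> Q t) ->
  {ae mu, forall t, P t} -> {ae mu, forall t, Q t}.
Proof. by move=> PQ; exact: (@filterS _ _ (ae_filter_ringOfSetsType mu)). Qed.

Lemma lipschitz_continuous_cc K a b f :
  lipschitz_with K a b f -> {within `[a, b], continuous f}.
Proof.
move=> fK; apply/subspace_continuousP => t /=; rewrite in_itv /= => tab.
apply/cvgrPdist_le => e e0.
have K0 : 0 < `|K| + 1 by rewrite ltr_wpDl.
near=> s; have sab : a <= s <= b.
  by have : `[a, b]%classic s; [near: s; exact: withinT | rewrite /= in_itv].
apply: (le_trans (fK _ _ tab sab)).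
apply: (@le_trans _ _ ((`|K| + 1) * `|t - s|)).
  by rewrite ler_wpM2r// (le_trans (ler_norm K))// lerDl.
rewrite -ler_pdivlMl//; near: s.
apply: cvgr_dist_le; first exact: cvg_within.
by rewrite mulr_gt0// invr_gt0.
Unshelve. all: by end_near. Qed.

Lemma continuous_bounded_measurable a b f :
  {within `[a, b], continuous f} -> bounded_measurable a b f.
Proof.
move=> cf; split; first exact: subspace_continuous_measurable_fun.
have /compact_bounded[N [_ H]] := continuous_compact cf (@segment_compact _ a b).
exists (N + 1) => t tab; apply: (H (N + 1)); first by rewrite ltrDl.
by exists t => //=; rewrite in_itv.
Qed.

Lemma lipschitz_bounded_measurable K a b f :
  lipschitz_with K a b f -> bounded_measurable a b f.
Proof. by move/lipschitz_continuous_cc/continuous_bounded_measurable. Qed.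

Lemma bounded_measurable_cst a b c : bounded_measurable a b (fun=> c).
Proof. by split; [exact: measurable_cst | exists `|c|]. Qed.

Lemma bounded_measurableD a b f g :
  bounded_measurable a b f -> bounded_measurable a b g ->
  bounded_measurable a b (fun t => f t + g t).
Proof.
move=> [mf [M fM]] [mg [N gN]]; split; first exact: measurable_funD.
exists (M + N) => t tab; apply: (le_trans (ler_normD _ _)).
by rewrite lerD ?fM ?gN.
Qed.

Lemma bounded_measurableM a b f g :
  bounded_measurable a b f -> bounded_measurable a b g ->
  bounded_measurable a b (fun t => f t * g t).
Proof.
move=> [mf [M fM]] [mg [N gN]]; split; first exact: measurable_funM.
by exists (M * N) => t tab; rewrite normrM ler_pM ?fM ?gN.
Qed.

Lemma bounded_measurable_sum a b (I : finType) (f : I -> R -> R) :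
  (forall i, bounded_measurable a b (f i)) ->
  bounded_measurable a b (fun t => \sum_i f i t).
Proof.
move=> H; elim: (index_enum I) => [|i s IH].
  by under eq_fun do rewrite big_nil; exact: bounded_measurable_cst.
by under eq_fun do rewrite big_cons; exact: bounded_measurableD.
Qed.

Lemma bounded_measurableN a b f :
  bounded_measurable a b f -> bounded_measurable a b (fun t => - f t).
Proof.
move=> [mf [M fM]]; split; first exact: measurableT_comp.
by exists M => t; rewrite normrN; exact: fM.
Qed.

Lemma bounded_measurableS a b c d f : a <= c -> d <= b ->
  bounded_measurable a b f -> bounded_measurable c d f.
Proof.
move=> ac db [mf [M fM]]; split.
  apply: measurable_funS mf => //.
  by apply: subset_itv; rewrite bnd_simp.
by exists M => t /andP[ct td]; apply: fM; rewrite (le_trans ac)//= (le_trans td).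
Qed.

Lemma bounded_measurable_integrable a b g :
  bounded_measurable a b g -> mu.-integrable `[a, b] (EFin \o g).
Proof.
move=> [mg [M gM]]; apply: measurable_bounded_integrable => //.
  by rewrite /= lebesgue_measure_itv/=; case: ifP => // _; rewrite -EFinB ltry.
exists M; split; first exact: num_real.
move=> N MN t /=; rewrite in_itv/= => tab; exact: le_trans (gM t tab) (ltW MN).
Qed.

Definition integral_cc a b g : R := (\int[mu]_(t in `[a, b]) g t)%R.

Lemma integral_ccE a b g : bounded_measurable a b g ->
  (\int[mu]_(t in `[a, b]) (g t)%:E = (integral_cc a b g)%:E)%E.
Proof.
move=> bg; rewrite /integral_cc /Rintegral fineK//.
exact: integrable_fin_num (bounded_measurable_integrable bg).
Qed.

Lemma integral_ccD a b f g :
  bounded_measurable a b f -> bounded_measurable a b g ->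
  integral_cc a b (fun t => f t + g t) = integral_cc a b f + integral_cc a b g.
Proof.
by move=> bf bg; rewrite /integral_cc RintegralD//; exact: bounded_measurable_integrable.
Qed.

Lemma integral_ccZ a b c f : bounded_measurable a b f ->
  integral_cc a b (fun t => c * f t) = c * integral_cc a b f.
Proof.
by move=> bf; rewrite /integral_cc RintegralZl//; exact: bounded_measurable_integrable.
Qed.

Lemma integral_cc_cst a b c : a <= b ->
  integral_cc a b (fun=> c) = c * (b - a).
Proof.
move=> ab; rewrite /integral_cc Rintegral_cst//= lebesgue_measure_itv/=.
case: ifPn; rewrite lte_fin; first by rewrite -EFinB.
by rewrite -leNgt => ba; rewrite (@le_anti _ _ a b) ?ab// subrr.
Qed.

Lemma ae_eq_integral_cc a b f g :
  bounded_measurable a b f -> bounded_measurable a b g ->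
  {ae mu, forall t, a <= t <= b -> f t = g t} ->
  integral_cc a b f = integral_cc a b g.
Proof.
move=> bf bg fg; rewrite /integral_cc /Rintegral; congr fine.
apply: ae_eq_integral => //.
- by apply/measurable_EFinP; case: bf.
- by apply/measurable_EFinP; case: bg.
by apply: ae_imply fg => t tab /=; rewrite in_itv/= => /tab ->.
Qed.

Lemma le_integral_cc a b f g :
  bounded_measurable a b f -> bounded_measurable a b g ->
  {ae mu, forall t, a <= t <= b -> f t <= g t} ->
  integral_cc a b f <= integral_cc a b g.
Proof.
move=> bf bg fg.
(* The maximum dominates [f] everywhere and equals [g] almost everywhere, so monotonicity of the
   integral is needed only for a pointwise inequality. *)
pose h t := Num.max (f t) (g t).
have bh : bounded_measurable a b h.
  case: bf bg => [mf [M fM]] [mg [N gN]]; split; first exact: measurable_maxr.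
  exists (M + N) => t tab; have := fM t tab; have := gN t tab.
  have := normr_ge0 (f t); have := normr_ge0 (g t).
  rewrite /h; case: (lerP (f t) (g t)) => _; lra.
rewrite (@ae_eq_integral_cc a b g h)//.
  apply: le_Rintegral => //; try exact: bounded_measurable_integrable.
  by move=> t _; rewrite /h le_max lexx.
by apply: ae_imply fg => t fg tab; rewrite /h; apply/esym/max_r/fg.
Qed.

Lemma integral_cc_sqr_eq0 a b f : bounded_measurable a b f ->
  integral_cc a b (fun t => f t ^+ 2) = 0 ->
  {ae mu, forall t, a <= t <= b -> f t = 0}.
Proof.
move=> bf f0.
have bf2 : bounded_measurable a b (fun t => f t ^+ 2) by exact: bounded_measurableM.
have m : measurable_fun `[a, b] (fun t => (f t ^+ 2)%:E).
  by apply/measurable_EFinP; case: bf2.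
have [+ _] := ae_eq_integral_abs (@lebesgue_measure R) (measurable_itv `[a, b]) m.
case.
  under eq_integral do rewrite /= ger0_norm ?sqr_ge0//.
  by rewrite integral_ccE// f0.
move=> N [mN N0 HN]; exists N; split=> // t; rewrite /= => H; apply: HN => /= H2.
apply: H => tab; have := H2; rewrite in_itv/= => /(_ tab) [] /eqP.
by rewrite sqrf_eq0 => /eqP.
Qed.

End LipschitzFunctions.

(** * The fundamental theorem of calculus for Lipschitz functions *)

Section LipschitzFTC.
Context {R : realType}.
Implicit Types (f g h : R -> R) (a b c t : R).
Local Notation mu := (@lebesgue_measure R).

(** Extends [f] from [[a, b]] by constants, so that difference quotients near [b] make sense and the
    Lipschitz bound becomes global. *)
Definition clamp a b f t := f (Num.max a (Num.min b t)).

Lemma clamp_itv a b t : a <= b -> a <= Num.max a (Num.min b t) <= b.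
Proof.
by move=> ab; rewrite le_max lexx/= ge_max ab/= ge_min lexx.
Qed.

Lemma clampE a b f t : a <= t <= b -> clamp a b f t = f t.
Proof. by move=> /andP[at_ tb]; rewrite /clamp (min_r tb) (max_r at_). Qed.

Lemma clamp_lipschitz K a b f s t : a <= b -> lipschitz_with K a b f ->
  `|clamp a b f s - clamp a b f t| <= `|K| * `|s - t|.
Proof.
move=> ab fK; apply: (le_trans (fK _ _ (clamp_itv s ab) (clamp_itv t ab))).
apply: (@le_trans _ _ (`|K| * `|Num.max a (Num.min b s) - Num.max a (Num.min b t)|)).
  by rewrite ler_wpM2r// ler_norm.
rewrite ler_wpM2l//.
have lip x y : `|Num.max a x - Num.max a y| <= `|x - y|.
  have := ler_norm (x - y); have := ler_norm (y - x); rewrite (distrC y x).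
  case: (leP a x) => ?; case: (leP a y) => ? ? ?; rewrite ?subrr ?normr0// ler_norml;
    apply/andP; split; lra.
apply: (le_trans (lip _ _)).
have := ler_norm (s - t); have := ler_norm (t - s); rewrite (distrC t s).
case: (leP b s) => ?; case: (leP b t) => ? ? ?; rewrite ?subrr ?normr0// ler_norml;
  apply/andP; split; lra.
Qed.

Lemma clamp_continuous K a b f : a <= b -> lipschitz_with K a b f ->
  continuous (clamp a b f).
Proof.
move=> ab fK t.
have LK : lipschitz_with `|K| (t - 1) (t + 1) (clamp a b f).
  by move=> s u _ _; exact: clamp_lipschitz fK.
have := lipschitz_continuous_cc LK.
have tt : t - 1 < t + 1 by lra.
move=> /(continuous_within_itvP _ tt)[+ _ _]; apply.
by rewrite in_itv/=; apply/andP; split; lra.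
Qed.

Lemma is_derive_cvg_seq f t l : is_derive t 1 f l ->
  (fun n : nat => n.+1%:R * (f (t + n.+1%:R^-1) - f t)) @ \oo --> l.
Proof.
move=> [df <-].
have : (fun h : R => h^-1 *: (f (h *: 1 + t) - f t)) @ 0^' --> 'D_1 f t by exact: df.
move=> H.
have harm : (fun n : nat => (n.+1%:R^-1 : R)) @ \oo --> 0^'.
  move=> P [e /= e0 HP].
  have := @cvg_harmonic R; move=> /cvgrPdist_lt /(_ _ e0); apply: filterS => n /=.
  move=> Hn; apply: HP => //=; by rewrite gt_eqF// invr_gt0.
have := cvg_comp _ _ harm H; apply: cvg_trans; apply: near_eq_cvg; near=> n.
by rewrite /= invrK /GRing.scale /= mulr1 (addrC _ t).
Unshelve. all: by end_near. Qed.

Section Quotients.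
Variables (K a b : R) (f : R -> R).
Hypothesis ab : a < b.
Hypothesis fK : lipschitz_with K a b f.

Let ff := clamp a b f.
Let cff : continuous ff := clamp_continuous (ltW ab) fK.
Definition quotient (n : nat) t := n.+1%:R * (ff (t + n.+1%:R^-1) - ff t).

Lemma quotient_le n t : `|quotient n t| <= `|K|.
Proof.
rewrite /quotient normrM ger0_norm ?ler0n// -ler_pdivlMl ?ltr0n//.
apply: (le_trans (clamp_lipschitz _ _ (ltW ab) fK)).
by rewrite addrAC subrr add0r [`|_^-1|]ger0_norm ?invr_ge0 ?ler0n// mulrC lexx.
Qed.

Lemma quotient_continuous n : continuous (quotient n).
Proof.
move=> t; apply: cvgM; first exact: cvg_cst.
apply: cvgB; last exact: cff.
apply: (@cvg_comp _ _ _ (fun t => t + n.+1%:R^-1) ff _ (nbhs (t + n.+1%:R^-1))).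
  by apply: cvgD; [exact: cvg_id|exact: cvg_cst].
exact: cff.
Qed.

Lemma quotient_cvg t d : a < t < b -> is_derive t 1 f d ->
  quotient ^~ t @ \oo --> d.
Proof.
move=> /andP[at_ tb] /is_derive_cvg_seq; apply: cvg_trans; apply: near_eq_cvg.
near=> n; rewrite /quotient /ff !clampE ?(ltW at_) ?(ltW tb)//.
have n0 : 0 < n.+1%:R^-1 :> R by rewrite invr_gt0.
suff : n.+1%:R^-1 <= b - t by move: n.+1%:R^-1 n0 => e e0 eb; apply/andP; split; lra.
near: n.
have bt : 0 < b - t by lra.
have := @cvg_harmonic R; move=> /cvgrPdist_lt /(_ _ bt); apply: filterS => n /=.
by rewrite sub0r normrN ger0_norm// => /ltW.
Unshelve. all: by end_near. Qed.

(** With a primitive [F] of the clamped function, the integral of a difference quotient is the mean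
    of that function just after [b] minus its mean just after [a]; both means converge by
    continuity. *)
Lemma quotient_integral_cvg :
  (fun n => integral_cc a b (quotient n)) @ \oo --> f b - f a.
Proof.
have a1a : a - 1 < a by rewrite ltrBlDr ltrDl.
have a1b := lt_trans a1a ab.
(* Starting at [a - 1] makes [a] an interior point, so that [F] has a two-sided derivative there. *)
pose F t := (\int[mu]_(s in `[a - 1, t]) ff s)%R.
have dF t : a - 1 < t -> is_derive t 1 F (ff t).
  move=> at_; have ut : t < t + 1 by lra.
  have iF : mu.-integrable `[a - 1, t + 1] (EFin \o ff).
    apply: continuous_compact_integrable; first exact: segment_compact.
    exact/continuous_subspaceT.
  have [d e] := continuous_FTC1_closed ut iF at_ (@cff t).
  by apply: DeriveDef; [exact: d | rewrite -derive1E e].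
have E n : integral_cc a b (quotient n) =
    n.+1%:R * (F (b + n.+1%:R^-1) - F b) - n.+1%:R * (F (a + n.+1%:R^-1) - F a).
  pose P t := n.+1%:R * (F (t + n.+1%:R^-1) - F t).
  have n0 : 0 < n.+1%:R^-1 :> R by rewrite invr_gt0.
  have dP t : a - 1 < t -> is_derive t 1 P (quotient n t).
    move=> at_; have d1 := dF _ at_.
    have at2 : a - 1 < t + n.+1%:R^-1 by move: n.+1%:R^-1 n0 => e e0; lra.
    have d2 : is_derive t 1 (fun t => F (t + n.+1%:R^-1)) (ff (t + n.+1%:R^-1)).
      have d0 := dF _ at2.
      have := @is_derive1_comp _ F (shift n.+1%:R^-1) t _ _ d0 (is_derive_shift _ _ _).
      by rewrite mulr1.
    exact: is_derive_scale (is_derive_add d2 (is_derive_opp d1)).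
  apply: EFin_inj; rewrite -integral_ccE; last first.
    exact/continuous_bounded_measurable/continuous_subspaceT/quotient_continuous.
  rewrite (@continuous_FTC2 _ (quotient n) P)//.
  - exact/continuous_subspaceT/quotient_continuous.
  - have cP t : a - 1 < t -> {for t, continuous P}.
      move=> at_; apply: differentiable_continuous; apply/derivable1_diffP.
      by case: (dP _ at_).
    split.
    + move=> t; rewrite in_itv/= => /andP[at_ _].
      by have [] : is_derive t 1 P (quotient n t) by apply/dP/(lt_trans a1a).
    + by apply: cvg_at_right_filter; exact: cP.
    + by apply: cvg_at_left_filter; exact: cP.
  - move=> t; rewrite in_itv/= => /andP[at_ _].
    have [_ <-] : is_derive t 1 P (quotient n t) by apply/dP/(lt_trans a1a).
    by rewrite derive1E.
under eq_fun do rewrite E.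
have -> : f b - f a = ff b - ff a.
  by rewrite /ff !clampE ?lexx ?(ltW ab).
by apply: cvgB; apply: is_derive_cvg_seq; exact: dF.
Qed.

Lemma quotient_bounded_measurable n : bounded_measurable a b (quotient n).
Proof.
exact/continuous_bounded_measurable/continuous_subspaceT/quotient_continuous.
Qed.

End Quotients.

(** Dominated convergence: the difference quotients are bounded by the Lipschitz constant and tend
    to [g] almost everywhere, while the limit of their integrals is known from
    [quotient_integral_cvg]. *)
Lemma lipschitz_FTC a b f g : a < b -> lipschitz_derivative a b f g ->
  integral_cc a b g = f b - f a.
Proof.
move=> ab [[K fK] bg dfg].
have cv1 := quotient_integral_cvg ab fK.
have bq := quotient_bounded_measurable ab fK.
have [|||||_ _ cv2] := @dominated_convergence _ _ R mu `[a, b]%classic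
  (measurable_itv _) (fun n => EFin \o quotient a b f n) (EFin \o g)
  (EFin \o (fun=> `|K|)).
- by move=> n; apply/measurable_EFinP; case: (bq n).
- by apply/measurable_EFinP; case: bg.
- apply: ae_imply (ae_and dfg (ae_and (ae_neq a) (ae_neq b))) => t.
  move=> [d [ta tb]] /=; rewrite in_itv/= => /[dup] tab /andP[at_ tb'].
  apply: cvg_EFin; first by near=> n.
  apply: quotient_cvg => //; last exact: d.
  by rewrite lt_neqAle eq_sym ta at_/= lt_neqAle tb.
- exact: bounded_measurable_integrable (bounded_measurable_cst _ _ _).
- by apply: aeW => t n _ /=; rewrite lee_fin; exact: quotient_le.
have cv3 : (fun n => integral_cc a b (quotient a b f n)) @ \oo --> integral_cc a b g.
  have := cv2; rewrite /= integral_ccE// => /fine_cvg.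
  apply: cvg_trans; apply: near_eq_cvg; near=> n.
  by rewrite /= integral_ccE.
exact: cvg_unique cv3 cv1.
Unshelve. all: by end_near. Qed.

Lemma lipschitz_derivative_ex a b f : a < b ->
  (exists K, lipschitz_with K a b f) ->
  {ae mu, forall t, a <= t <= b -> derivable f t 1} ->
  exists g, lipschitz_derivative a b f g.
Proof.
move=> ab [K fK] df.
(* The upper limit of continuous functions is Borel, whether or not the quotients converge.
   Truncating it at the Lipschitz constant makes it bounded everywhere and changes nothing where [f]
   is differentiable. *)
pose q := quotient a b f; pose g0 t := limn_sup (q ^~ t).
pose g t := Num.max (- `|K|) (Num.min `|K| (g0 t)).
have qK := quotient_le ab fK.
have mg0 : measurable_fun `[a, b] g0.
  apply: measurable_fun_limn_sup.
  - by move=> t _; exists `|K| => _ [n _ <-]; exact: le_trans (ler_norm _) (qK _ _).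
  - move=> t _; exists (- `|K|) => _ [n _ <-].
    by have := qK n t; rewrite ler_norml => /andP[].
  - by move=> n; have [] := quotient_bounded_measurable ab fK n.
exists g; split; first by exists K.
  split.
    apply: measurable_maxr => //.
    exact: measurable_minr.
  exists `|K| => t _; rewrite ler_norml le_max lexx/= ge_max ge_min lexx/= andbT.
  by rewrite (le_trans _ (normr_ge0 K))// oppr_le0.
apply: ae_imply (ae_and df (ae_and (ae_neq a) (ae_neq b))) => t.
move=> [d [ta tb]] /[dup] tab /andP[at_ tb']; have {}d := derivableP (d tab).
have tab' : a < t < b by rewrite lt_neqAle eq_sym ta at_/= lt_neqAle tb.
have cq := quotient_cvg tab' d.
have g0E : g0 t = 'D_1 f t.
  rewrite /g0 cvg_limn_supE; first exact: (cvg_lim _ cq).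
  by apply/cvg_ex; eexists; exact: cq.
have dK : `|'D_1 f t| <= `|K|.
  rewrite -(cvg_lim _ (cvg_norm cq))//.
  apply: limr_le; first by apply/cvg_ex; eexists; exact: cvg_norm cq.
  by near=> n; exact: qK.
suff -> : g t = 'D_1 f t by [].
move: dK; rewrite ler_norml => /andP[d1 d2].
by rewrite /g g0E (min_r d2) max_r.
Unshelve. all: by end_near. Qed.

End LipschitzFTC.

(** * Product rule, primitives and the du Bois-Reymond lemma *)

Section LipschitzCalculus.
Import HBNNSimple.
Context {R : realType}.
Implicit Types (f g h : R -> R) (a b c t : R).
Local Notation mu := (@lebesgue_measure R).

Lemma lipschitz_derivative_cst a b c :
  lipschitz_derivative a b (fun=> c) (fun=> 0).
Proof.
split; first by exists 0 => s t _ _; rewrite subrr normr0 mul0r.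
  exact: bounded_measurable_cst.
by apply: aeW => t _; exact: is_derive_cst.
Qed.

Lemma lipschitz_derivative_id a b : lipschitz_derivative a b id (fun=> 1).
Proof.
split; first by exists 1 => s t _ _; rewrite mul1r.
  exact: bounded_measurable_cst.
by apply: aeW => t _; exact: is_derive_id.
Qed.

Lemma lipschitz_derivativeD a b f f' g g' :
  lipschitz_derivative a b f f' -> lipschitz_derivative a b g g' ->
  lipschitz_derivative a b (fun t => f t + g t) (fun t => f' t + g' t).
Proof.
move=> [[K fK] bf df] [[L gL] bg dg]; split.
- exists (K + L) => s t sab tab; rewrite opprD addrACA mulrDl.
  by rewrite (le_trans (ler_normD _ _))// lerD ?fK ?gL.
- exact: bounded_measurableD.
- by apply: ae_imply (ae_and df dg) => t [d e] tab; apply: is_derive_add; auto.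
Qed.

Lemma lipschitz_derivativeM a b f f' g g' :
  lipschitz_derivative a b f f' -> lipschitz_derivative a b g g' ->
  lipschitz_derivative a b (fun t => f t * g t)
    (fun t => f' t * g t + f t * g' t).
Proof.
move=> [[K fK] bf df] [[L gL] bg dg].
have bf0 := lipschitz_bounded_measurable fK.
have bg0 := lipschitz_bounded_measurable gL.
split.
- have [_ [M fM]] := bf0; have [_ [N gN]] := bg0.
  exists (K * N + M * L) => s t sab tab.
  rewrite [X in `|X|](_ : _ = (f s - f t) * g s + f t * (g s - g t)); last by ring.
  rewrite [leRHS](_ : _ = K * `|s - t| * N + M * (L * `|s - t|)); last by ring.
  rewrite (le_trans (ler_normD _ _))// !normrM lerD//.
    by rewrite ler_pM ?fK ?gN.
  by rewrite ler_pM ?fM ?gL.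
- by apply: bounded_measurableD; exact: bounded_measurableM.
- by apply: ae_imply (ae_and df dg) => t [d e] tab; apply: is_derive_mul; auto.
Qed.

Lemma lipschitz_derivativeZ a b c f f' :
  lipschitz_derivative a b f f' ->
  lipschitz_derivative a b (fun t => c * f t) (fun t => c * f' t).
Proof.
move=> H; have := lipschitz_derivativeM (lipschitz_derivative_cst a b c) H.
by under [X in lipschitz_derivative _ _ _ X]eq_fun do rewrite mul0r add0r.
Qed.

Lemma lipschitz_derivativeB a b f f' g g' :
  lipschitz_derivative a b f f' -> lipschitz_derivative a b g g' ->
  lipschitz_derivative a b (fun t => f t - g t) (fun t => f' t - g' t).
Proof.
move=> H /(lipschitz_derivativeZ (-1)) /(lipschitz_derivativeD H).
under eq_fun do rewrite mulN1r.
by under [X in lipschitz_derivative _ _ _ X]eq_fun do rewrite mulN1r.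
Qed.

Lemma lipschitz_derivative_sum a b (I : finType) (f f' : I -> R -> R) :
  (forall i, lipschitz_derivative a b (f i) (f' i)) ->
  lipschitz_derivative a b (fun t => \sum_i f i t) (fun t => \sum_i f' i t).
Proof.
move=> H; elim: (index_enum I) => [|i r IH].
  under eq_fun do rewrite big_nil.
  under [X in lipschitz_derivative _ _ _ X]eq_fun do rewrite big_nil.
  exact: lipschitz_derivative_cst.
under eq_fun do rewrite big_cons.
under [X in lipschitz_derivative _ _ _ X]eq_fun do rewrite big_cons.
exact: lipschitz_derivativeD.
Qed.

Lemma lipschitz_derivativeS a b c d f f' : a <= c -> d <= b ->
  lipschitz_derivative a b f f' -> lipschitz_derivative c d f f'.
Proof.
move=> ac db [[K fK] bf df].
have sub t : c <= t <= d -> a <= t <= b.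
  by move=> /andP[ct td]; rewrite (le_trans ac ct) (le_trans td db).
split.
- by exists K => s t /sub sab /sub; exact: fK.
- exact: bounded_measurableS bf.
- by apply: ae_imply df => t + /sub; apply.
Qed.

Lemma lipschitz_derivative_C1 a b f f' : a < b ->
  (forall t, a < t < b -> is_derive t 1 f (f' t)) ->
  {within `[a, b], continuous f} -> {within `[a, b], continuous f'} ->
  lipschitz_derivative a b f f'.
Proof.
move=> ab df cf cf'; have [m [M fM]] := continuous_bounded_measurable cf'.
split; [|by split => //; exists M|]; last first.
  apply: ae_imply (ae_and (ae_neq a) (ae_neq b)) => t [ta tb] /andP[at_ tb'].
  by apply: df; rewrite lt_neqAle eq_sym ta at_/= lt_neqAle tb.
have wlip s t : a <= s <= b -> a <= t <= b -> s < t -> `|f s - f t| <= M * `|s - t|.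
  move=> /andP[as_ sb] /andP[at_ tb] st.
  have [||c] := @MVT _ f f' s t st.
  - move=> x; rewrite in_itv/= => /andP[sx xt]; apply: df.
    by rewrite (le_lt_trans as_ sx) (lt_le_trans xt tb).
  - apply: continuous_subspaceW cf.
    by apply: subset_itv; rewrite bnd_simp.
  rewrite in_itv/= => /andP[sc ct] E.
  rewrite distrC E normrM (distrC t) ler_wpM2r//; apply: fM.
  by rewrite (le_trans as_ (ltW sc)) (le_trans (ltW ct) tb).
exists M => s t sab tab; case: (ltgtP s t) => [st|ts|->].
- exact: wlip.
- by rewrite distrC (distrC s); exact: wlip.
- by rewrite !subrr normr0 mulr0.
Qed.

(** The integrand is cut off outside [[a, b]], where nothing is known of [g]; this makes it
    integrable on every bounded interval, as the Lebesgue differentiation theorem requires. *)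
Definition primitive a b g t := (\int[mu]_(s in `[a, t]) (g \_ `[a, b]) s)%R.

Lemma primitive_left a b g : primitive a b g a = 0.
Proof. by rewrite /primitive set_itv1 Rintegral_set1. Qed.

Lemma primitive_derivative a b g : a < b -> bounded_measurable a b g ->
  lipschitz_derivative a b (primitive a b g) g.
Proof.
move=> ab bg; pose h := g \_ `[a, b].
have hE t : a <= t <= b -> h t = g t by move=> tab; rewrite /h patchE mem_set//= in_itv.
have [M0 hM] : exists M, forall t, `|h t| <= M.
  have [_ [M gM]] := bg; exists (Num.max 0 M) => t.
  rewrite /h patchE; case: ifPn; last by rewrite normr0 le_max lexx.
  by rewrite inE /= in_itv/= => /gM; rewrite le_max orbC => ->.
have mh : measurable_fun setT h.
  have [m _] := bg.
  apply/(measurable_restrictT _ _).1; first exact: measurable_itv.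
  exact: m.
have bh c d : bounded_measurable c d h.
  split; first exact: measurable_funTS.
  by exists M0.
have ih c d : mu.-integrable `[c, d] (EFin \o h).
  exact: bounded_measurable_integrable (bh c d).
split => //.
  have wlip s t : a <= s <= b -> a <= t <= b -> s <= t ->
      `|primitive a b g s - primitive a b g t| <= M0 * `|s - t|.
    move=> /andP[as_ sb] /andP[at_ tb] st.
    rewrite distrC /primitive (@Rintegral_itvB _ h (BLeft a) (BRight t) s (ih a t)) ?bnd_simp//.
    rewrite Rintegral_itv_obnd_cbnd; last first.
      by apply: integrableS (ih s t) => //; apply: subset_itv; rewrite bnd_simp.
    apply: (le_trans (le_normr_Rintegral _ (ih s t))) => //.
    rewrite distrC (ger0_norm (_ : 0 <= t - s)) ?subr_ge0//.
    rewrite -integral_cc_cst//; apply: le_integral_cc.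
    - have [m [N H]] := bh s t; split; first exact: measurableT_comp.
      by exists N => u /H; rewrite normr_id.
    - exact: bounded_measurable_cst.
    - by apply: aeW.
  exists M0 => s t sab tab; case: (leP s t) => [st|/ltW ts]; first exact: wlip.
  by rewrite distrC (distrC s); exact: wlip.
have li : locally_integrable [set: R] h.
  by apply: integrable_locally_restrict => //; exact: bounded_measurable_integrable.
have ih' y : mu.-integrable [set` Interval (BLeft a) (BRight y)] (EFin \o h).
  exact: ih.
have := FTC1 ih' li.
move=> /= /ae_and /(_ (ae_neq a)); apply: ae_imply => t [H ta] /andP[at_ tb].
have [|d e] := H; first by rewrite lte_fin lt_neqAle eq_sym ta.
by apply: DeriveDef; [exact: d | rewrite -derive1E e hE// at_].
Qed.

(* Tested with the primitive of [g] minus its mean. *)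
Lemma duBois_Reymond a b g : a < b -> bounded_measurable a b g ->
  (forall phi phi', lipschitz_derivative a b phi phi' -> phi a = 0 -> phi b = 0 ->
     integral_cc a b (fun t => phi' t * g t) = 0) ->
  exists c, {ae mu, forall t, a <= t <= b -> g t = c}.
Proof.
move=> ab bg H; pose c := integral_cc a b g / (b - a); exists c.
have b0 : b - a != 0 by rewrite subr_eq0 gt_eqF.
pose k t := g t - c.
have bk : bounded_measurable a b k.
  by apply: bounded_measurableD => //; exact: bounded_measurable_cst.
have dk := primitive_derivative ab bk.
have Ik : integral_cc a b k = 0.
  rewrite /k integral_ccD//; last exact: bounded_measurable_cst.
  by rewrite integral_cc_cst ?(ltW ab)// mulNr /c mulfVK// subrr.
have kb : primitive a b k b = 0.
  by have := lipschitz_FTC ab dk; rewrite primitive_left subr0 Ik.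
have /integral_cc_sqr_eq0 : integral_cc a b (fun t => k t ^+ 2) = 0.
  rewrite (_ : (fun t => k t ^+ 2) = (fun t => k t * g t + - c * k t)); last first.
    by apply/funext => t; rewrite /k; ring.
  rewrite integral_ccD; [|exact: bounded_measurableM|]; last first.
    by apply: bounded_measurableM => //; exact: bounded_measurable_cst.
  by rewrite (H _ _ dk (primitive_left _ _ _) kb) integral_ccZ// Ik mulr0 addr0.
move=> /(_ bk); apply: ae_imply => t /[apply] /eqP.
by rewrite subr_eq0 => /eqP.
Qed.

(** The integral of a nonnegative function is a supremum over simple functions below it. Killing
    such a simple function on [N] keeps its integral and puts it below [g], so neither [f] nor [g]
    has to be measurable. *)
Lemma le_nnintegral_ae (f g : R -> \bar R) (N : set R) :
  measurable N -> mu N = 0%E -> (forall t, 0 <= f t)%E -> (forall t, 0 <= g t)%E ->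
  (forall t, ~ N t -> f t = g t) ->
  (\int[mu]_t f t <= \int[mu]_t g t)%E.
Proof.
move=> mN N0 f0 g0 fg.
rewrite [leLHS]ge0_integralTE// [leRHS]ge0_integralTE//.
apply: ge_ereal_sup => _ [h /= hf <-].
pose h' := proj_nnsfun h (measurableC mN).
have h'E t : h' t = h t * \1_(~` N) t by [].
have -> : sintegral mu h = sintegral mu h'.
  rewrite -!integralT_nnsfun; apply: ae_eq_integral => //.
  - by apply/measurable_EFinP; exact: measurable_funP.
  - by apply/measurable_EFinP; exact: measurable_funP.
  exists N; split => // t /= /not_implyP[_]; apply: contra_notP => Nt.
  by rewrite -[X in _ = X%:E]/(h' t) h'E indicE mem_set// mulr1.
apply: ereal_sup_ubound; exists h' => // t; rewrite h'E indicE.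
case: (pselect (N t)) => Nt.
  by rewrite memNset ?mulr0//; apply.
by rewrite mem_set// mulr1 -fg.
Qed.

Lemma ae_eq_nnintegral (f g : R -> \bar R) :
  (forall t, 0 <= f t)%E -> (forall t, 0 <= g t)%E ->
  {ae mu, forall t, f t = g t} ->
  (\int[mu]_t f t = \int[mu]_t g t)%E.
Proof.
move=> f0 g0 [N [mN N0 fg]].
have E t : ~ N t -> f t = g t by move=> Nt; apply: contrapT => H; apply: Nt; exact: fg.
apply/eqP; rewrite eq_le; apply/andP; split.
  exact: (le_nnintegral_ae mN).
by apply: (le_nnintegral_ae mN) => // t /E ->.
Qed.

(* Lebesgue measure lives on the Borel sets only, so [f] need not be measurable
   here: this is why [ae_eq_integral] does not apply. *)
Lemma ae_eq_integral_ge0 a b f g :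
  (forall t, 0 <= g t) ->
  {ae mu, forall t, a <= t <= b -> f t = g t} ->
  (\int[mu]_(t in `[a, b]) (f t)%:E = \int[mu]_(t in `[a, b]) (g t)%:E)%E.
Proof.
move=> g0 fg.
rewrite integralE [RHS]integralE; congr (_ - _)%E.
  rewrite integral_mkcond [RHS]integral_mkcond; apply: ae_eq_nnintegral.
  - by move=> t; apply: erestrict_ge0 => s _; exact: funepos_ge0.
  - by move=> t; apply: erestrict_ge0 => s _; exact: funepos_ge0.
  apply: ae_imply fg => t fg; rewrite !patchE; case: ifPn => //.
  by rewrite inE/= in_itv/= => /fg H; rewrite !funeposE H.
rewrite integral_mkcond [RHS]integral_mkcond; apply: ae_eq_nnintegral.
- by move=> t; apply: erestrict_ge0 => s _; exact: funeneg_ge0.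
- by move=> t; apply: erestrict_ge0 => s _; exact: funeneg_ge0.
apply: ae_imply fg => t fg; rewrite !patchE; case: ifPn => //.
by rewrite inE/= in_itv/= => /fg H; rewrite !funenegE H.
Qed.

End LipschitzCalculus.

(** * Exponential coordinates *)

Section BilinearForms.
Context {R : realType} {m : nat}.
Implicit Types (x y z : 'rV[R]_m) (A : 'M[R]_m).

Definition dotp x y : R := \sum_i x 0 i * y 0 i.

Lemma dotpC x y : dotp x y = dotp y x.
Proof. by apply: eq_bigr => i _; rewrite mulrC. Qed.

Lemma dotpDl x y z : dotp (x + y) z = dotp x z + dotp y z.
Proof. by rewrite -big_split; apply: eq_bigr => i _; rewrite mxE mulrDl. Qed.

Lemma dotpZl (c : R) x y : dotp (c *: x) y = c * dotp x y.
Proof. by rewrite mulr_sumr; apply: eq_bigr => i _; rewrite mxE mulrA. Qed.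

Lemma dotpDr x y z : dotp x (y + z) = dotp x y + dotp x z.
Proof. by rewrite dotpC dotpDl !(dotpC x). Qed.

Lemma dotpZr (c : R) x y : dotp x (c *: y) = c * dotp x y.
Proof. by rewrite dotpC dotpZl dotpC. Qed.

Lemma dotpNl x y : dotp (- x) y = - dotp x y.
Proof. by rewrite -scaleN1r dotpZl mulN1r. Qed.

Lemma dotpNr x y : dotp x (- y) = - dotp x y.
Proof. by rewrite dotpC dotpNl dotpC. Qed.

Lemma dotpBl x y z : dotp (x - y) z = dotp x z - dotp y z.
Proof. by rewrite dotpDl dotpNl. Qed.

Lemma dotpBr x y z : dotp x (y - z) = dotp x y - dotp x z.
Proof. by rewrite dotpDr dotpNr. Qed.

Lemma dotp0l y : dotp 0 y = 0.
Proof. by rewrite -(scale0r 0) dotpZl mul0r. Qed.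

Lemma dotp0r x : dotp x 0 = 0.
Proof. by rewrite dotpC dotp0l. Qed.

Lemma dotp_suml (I : finType) (f : I -> 'rV[R]_m) y :
  dotp (\sum_i f i) y = \sum_i dotp (f i) y.
Proof.
elim: (index_enum I) => [|i r IH]; first by rewrite !big_nil dotp0l.
by rewrite !big_cons dotpDl IH.
Qed.

Lemma dotp_sumr (I : finType) (f : I -> 'rV[R]_m) x :
  dotp x (\sum_i f i) = \sum_i dotp x (f i).
Proof. by rewrite dotpC dotp_suml; apply: eq_bigr => i _; rewrite dotpC. Qed.

Lemma dotpE x y : dotp x y = (x *m y^T) 0 0.
Proof. by rewrite mxE; apply: eq_bigr => i _; rewrite mxE. Qed.

Lemma dotp_mulmx A x y : dotp (x *m A) y = dotp x (y *m A^T).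
Proof. by rewrite !dotpE trmx_mul trmxK mulmxA. Qed.

Lemma dotp_delta x i : dotp (delta_mx 0 i) x = x 0 i.
Proof.
rewrite /dotp (bigD1 i)//= mxE !eqxx mul1r big1 ?addr0// => j ji.
by rewrite mxE eqxx/= (negbTE ji) mul0r.
Qed.

Lemma dotp_ge0 x : 0 <= dotp x x.
Proof. by apply: sumr_ge0 => i _; rewrite -expr2 sqr_ge0. Qed.

Lemma dotp_eq0 x : (dotp x x == 0) = (x == 0).
Proof.
apply/idP/eqP => [|->]; last by rewrite dotp0l.
rewrite psumr_eq0 => [/allP H|i _]; last by rewrite -expr2 sqr_ge0.
apply/rowP => i; rewrite mxE; have := H i; rewrite mem_index_enum => /(_ isT).
by rewrite -expr2 sqrf_eq0 => /eqP.
Qed.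

Lemma dotp_gt0 x : (0 < dotp x x) = (x != 0).
Proof. by rewrite lt_neqAle dotp_ge0 andbT eq_sym dotp_eq0. Qed.

End BilinearForms.

Section Coordinates.
Context {R : realType} {n : nat} {G : contactCarnot R n}.
Local Notation m := (2 * n)%N.
Local Notation A := (cc_A G).
Local Notation mu := (@lebesgue_measure R).
Implicit Types (p q : G) (x y : 'rV[R]_m) (z w : R).

Lemma cc_frame_basis : basis_of fullv (cc_frame (G := G)).
Proof.
rewrite basisEdim /= size_tuple cc_dim leqnn andbT span_cons.
by rewrite (span_basis (cc_f_basis G)) cc_f0_gen addvC cc_sum.
Qed.

Lemma tnth_frame0 : tnth (cc_frame (G := G)) ord0 = cc_f0 G.
Proof. by []. Qed.

Lemma tnth_frameS i : tnth (cc_frame (G := G)) (lift ord0 i) = tnth (cc_f G) i.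
Proof. by rewrite !(tnth_nth 0). Qed.

Lemma cc_f0_neq0 : cc_f0 G != 0.
Proof.
by apply/eqP => f0; have := cc_dim2 G; rewrite -cc_f0_gen f0 dim_vline eqxx.
Qed.

Definition xcoord p : 'rV[R]_m := \row_i ecoord (lift ord0 i) p.
Definition zcoord p : R := ecoord ord0 p.
Definition horizontal_part x : cc_alg G := \sum_i x 0 i *: tnth (cc_f G) i.

Lemma cc_logE p : cc_log p = horizontal_part (xcoord p) + zcoord p *: cc_f0 G.
Proof.
rewrite {1}(coord_basis cc_frame_basis (memvf (cc_log p))) big_ord_recl addrC.
congr (_ + _); apply: eq_bigr => i _; rewrite !mxE.
by rewrite -tnth_nth tnth_frameS.
Qed.

Lemma ecoordsK p : ecoords (xcoord p) (zcoord p) = p.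
Proof. by rewrite /ecoords -[X in cc_exp X]cc_logE cc_logK. Qed.

Lemma coord_frame x z i : coord (cc_frame (G := G)) i (horizontal_part x + z *: cc_f0 G) =
  if unlift ord0 i is Some j then x 0 j else z.
Proof.
pose k (i : 'I_m.+1) := if unlift ord0 i is Some j then x 0 j else z.
have -> : horizontal_part x + z *: cc_f0 G = \sum_i k i *: (cc_frame (G := G))`_i.
  rewrite big_ord_recl addrC /k unlift_none; congr (_ + _).
  by apply: eq_bigr => j _; rewrite liftK -tnth_nth tnth_frameS.
by rewrite coord_sum_free// (basis_free cc_frame_basis).
Qed.

Lemma xcoordE x z : xcoord (ecoords x z) = x.
Proof. by apply/rowP => i; rewrite mxE /ecoord cc_expK coord_frame liftK. Qed.

Lemma zcoordE x z : zcoord (ecoords x z : G) = z.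
Proof. by rewrite /zcoord /ecoord cc_expK coord_frame unlift_none. Qed.

Lemma cc_brDl X Y Z : cc_br (X + Y) Z = cc_br X Z + cc_br Y Z :> cc_alg G.
Proof. by have [H _ _ _] := cc_lie G; have := H Z 1 X Y; rewrite !scale1r. Qed.

Lemma cc_brDr X Y Z : cc_br X (Y + Z) = cc_br X Y + cc_br X Z :> cc_alg G.
Proof. by have [_ H _ _] := cc_lie G; have := H X 1 Y Z; rewrite !scale1r. Qed.

Lemma cc_br0l X : cc_br 0 X = 0 :> cc_alg G.
Proof. by apply: (addrI (cc_br 0 X)); rewrite -cc_brDl !addr0. Qed.

Lemma cc_br0r X : cc_br X 0 = 0 :> cc_alg G.
Proof. by apply: (addrI (cc_br X 0)); rewrite -cc_brDr !addr0. Qed.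

Lemma cc_brZl (c : R) X Y : cc_br (c *: X) Y = c *: cc_br X Y :> cc_alg G.
Proof. by have [H _ _ _] := cc_lie G; have := H Y c X 0; rewrite !addr0 cc_br0l addr0. Qed.

Lemma cc_brZr (c : R) X Y : cc_br X (c *: Y) = c *: cc_br X Y :> cc_alg G.
Proof. by have [_ H _ _] := cc_lie G; have := H X c Y 0; rewrite !addr0 cc_br0r addr0. Qed.

Lemma cc_br_suml (I : finType) (f : I -> cc_alg G) Y :
  cc_br (\sum_i f i) Y = \sum_i cc_br (f i) Y.
Proof.
elim: (index_enum I) => [|i r IH]; first by rewrite !big_nil cc_br0l.
by rewrite !big_cons cc_brDl IH.
Qed.

Lemma cc_br_sumr (I : finType) (f : I -> cc_alg G) X :
  cc_br X (\sum_i f i) = \sum_i cc_br X (f i).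
Proof.
elim: (index_enum I) => [|i r IH]; first by rewrite !big_nil cc_br0r.
by rewrite !big_cons cc_brDr IH.
Qed.

Lemma cc_brXX X : cc_br X X = 0 :> cc_alg G.
Proof. by have [_ _ H _] := cc_lie G. Qed.

Lemma cc_brC X Y : cc_br X Y = - cc_br Y X :> cc_alg G.
Proof.
apply/eqP; rewrite -addr_eq0; apply/eqP; have := cc_brXX (X + Y).
by rewrite cc_brDl !cc_brDr !cc_brXX add0r addr0.
Qed.

Lemma cc_br_g12 X Y : X \in cc_g1 G -> Y \in cc_g2 G -> cc_br X Y = 0.
Proof.
move=> /coord_vbasis -> /coord_vbasis ->.
rewrite cc_br_suml big1// => i _; rewrite cc_br_sumr big1// => j _.
rewrite cc_brZl cc_brZr; suff -> : cc_br (vbasis (cc_g1 G))`_i (vbasis (cc_g2 G))`_j = 0.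
  by rewrite !scaler0.
apply/eqP; rewrite -memv0 -(cc_br12 G); apply: memv_span.
by apply: allpairs_f; apply: mem_nth; rewrite size_tuple.
Qed.

Lemma cc_f_g1 i : tnth (cc_f G) i \in cc_g1 G.
Proof. by rewrite (basis_mem (cc_f_basis G))// mem_tnth. Qed.

Lemma cc_f0_g2 : cc_f0 G \in cc_g2 G.
Proof. by rewrite -cc_f0_gen memv_line. Qed.

(** Since [f_0] is central, only the brackets of the [f_i] among themselves survive. *)
Lemma cc_br_frame x z y w :
  cc_br (horizontal_part x + z *: cc_f0 G) (horizontal_part y + w *: cc_f0 G) =
  dotp (x *m A) y *: cc_f0 G.
Proof.
have hg1 u : horizontal_part u \in cc_g1 G.
  by apply: memv_suml => i _; apply: memvZ; exact: cc_f_g1.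
rewrite cc_brDl !cc_brDr !cc_brZl !cc_brZr cc_brXX !scaler0 addr0.
rewrite (cc_br_g12 (hg1 x) cc_f0_g2) scaler0 addr0.
rewrite (cc_brC (cc_f0 G)) (cc_br_g12 (hg1 y) cc_f0_g2) oppr0 scaler0 addr0.
rewrite cc_br_suml /dotp.
under eq_bigr do rewrite cc_br_sumr.
rewrite exchange_big /= scaler_suml; apply: eq_bigr => j _.
rewrite mxE mulr_suml scaler_suml; apply: eq_bigr => i _.
by rewrite cc_brZl cc_brZr cc_AE !scalerA mulrAC.
Qed.

Lemma cc_A_skew : A^T = - A.
Proof.
apply/matrixP => i j; rewrite !mxE; apply/eqP.
have := cc_brC (tnth (cc_f G) i) (tnth (cc_f G) j).
rewrite !cc_AE -scaleNr => /eqP; rewrite -subr_eq0 -scalerBl scaler_eq0.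
by rewrite (negbTE cc_f0_neq0) orbF subr_eq0 -eqr_oppLR eq_sym.
Qed.

Lemma area_skew x y : dotp (x *m A) y = - dotp (y *m A) x.
Proof. by rewrite dotp_mulmx cc_A_skew mulmxN dotpNr dotpC. Qed.

Lemma area_diag x : dotp (x *m A) x = 0.
Proof.
by apply/eqP; rewrite -[_ == 0](mulrn_eq0 _ 2) mulr2n {1}area_skew addNr.
Qed.

Lemma cc_logM p q : cc_log (p * q)%g =
  horizontal_part (xcoord p + xcoord q) +
  (zcoord p + zcoord q + 2^-1 * dotp (xcoord p *m A) (xcoord q)) *: cc_f0 G.
Proof.
rewrite -{1}(cc_logK p) -{1}(cc_logK q) cc_BCH cc_expK.
rewrite (cc_logE p) (cc_logE q) cc_br_frame addrACA -scalerDl scalerA.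
rewrite [in RHS]scalerDl addrA; congr (_ + _ + _).
by rewrite -big_split; apply: eq_bigr => i _; rewrite !mxE scalerDl.
Qed.

Lemma xcoordM p q : xcoord (p * q)%g = xcoord p + xcoord q.
Proof. by apply/rowP => i; rewrite mxE /ecoord cc_logM coord_frame liftK. Qed.

Lemma zcoordM p q : zcoord (p * q)%g =
  zcoord p + zcoord q + 2^-1 * dotp (xcoord p *m A) (xcoord q).
Proof. by rewrite /zcoord /ecoord cc_logM coord_frame unlift_none. Qed.

Lemma cc_one : (1%g : G) = cc_exp 0.
Proof.
apply: (@mulgI _ (cc_exp 0 : G)); rewrite mulg1 cc_BCH cc_br0l.
by rewrite scaler0 !addr0.
Qed.

Lemma xcoord1 : xcoord (1%g : G) = 0.
Proof.
by apply/rowP => i; rewrite !mxE /ecoord cc_one cc_expK linear0.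
Qed.

Lemma zcoord1 : zcoord (1%g : G) = 0.
Proof. by rewrite /zcoord /ecoord cc_one cc_expK linear0. Qed.

Lemma xcoordV p : xcoord (p^-1)%g = - xcoord p.
Proof. by apply/eqP; rewrite -addr_eq0 -xcoordM mulVg xcoord1. Qed.

Lemma zcoordV p : zcoord (p^-1)%g = - zcoord p.
Proof.
apply/eqP; rewrite -addr_eq0; apply/eqP; have := zcoordM (p^-1)%g p.
by rewrite mulVg zcoord1 xcoordV mulNmx dotpNl area_diag oppr0 mulr0 addr0.
Qed.

Lemma left_translatedS (gamma : R -> G) t i s :
  left_translated gamma t (lift ord0 i) s =
  xcoord (gamma s) 0 i - xcoord (gamma t) 0 i.
Proof.
have xE p : xcoord p 0 i = ecoord (lift ord0 i) p by rewrite mxE.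
by rewrite /left_translated -xE xcoordM xcoordV [LHS]mxE [X in X + _]mxE addrC.
Qed.

Lemma left_translated0 (gamma : R -> G) t s :
  left_translated gamma t ord0 s =
  zcoord (gamma s) - zcoord (gamma t)
  - 2^-1 * dotp (xcoord (gamma t) *m A) (xcoord (gamma s)).
Proof.
by rewrite /left_translated -/(zcoord _) zcoordM zcoordV xcoordV mulNmx dotpNl mulrN
  (addrC (- zcoord _)).
Qed.

End Coordinates.

(** * Horizontal curves as Lipschitz curves with an area equation *)

Section HorizontalCurves.
Context {R : realType} {n : nat} {G : contactCarnot R n}.
Local Notation m := (2 * n)%N.
Local Notation A := (cc_A G).
Local Notation mu := (@lebesgue_measure R).
Implicit Types (p q : G) (x y : 'rV[R]_m) (u : R -> 'rV[R]_m) (z w a b t : R) (gamma : R -> G).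

Lemma horizontal_part_g1 x : horizontal_part x \in cc_g1 G.
Proof. by apply: memv_suml => i _; apply: memvZ; exact: cc_f_g1. Qed.

Lemma mem_g1 x w : (horizontal_part x + w *: cc_f0 G \in cc_g1 G) = (w == 0).
Proof.
rewrite rpredDl; last exact: horizontal_part_g1.
apply/idP/eqP => [H|->]; last by rewrite scale0r mem0v.
have /directv_addP D := cc_direct G.
have : w *: cc_f0 G \in (cc_g1 G :&: cc_g2 G)%VS.
  by rewrite memv_cap H memvZ// cc_f0_g2.
rewrite D memv0 scaler_eq0 (negbTE cc_f0_neq0) orbF => /eqP; exact.
Qed.

Lemma cc_dot_horizontal x y :
  cc_dot (horizontal_part x) (horizontal_part y : cc_alg G) = dotp x y.
Proof.
have [lin sym _] := cc_dotP G.
have dot0 Y : Y \in cc_g1 G -> cc_dot 0 Y = 0.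
  move=> Yg; have := lin 0 0 Y (mem0v _) (mem0v _) Yg 1.
  by rewrite scaler0 addr0 mul1r => /eqP; rewrite -subr_eq0 opprD addNKr oppr_eq0 => /eqP.
have dotl (u : 'rV[R]_m) Y : Y \in cc_g1 G ->
    cc_dot (horizontal_part u) Y = \sum_i u 0 i * cc_dot (tnth (cc_f G) i) Y.
  move=> Yg; rewrite /horizontal_part.
  suff [] : \sum_i u 0 i *: tnth (cc_f G) i \in cc_g1 G /\
    cc_dot (\sum_i u 0 i *: tnth (cc_f G) i) Y =
      \sum_i u 0 i * cc_dot (tnth (cc_f G) i) Y by [].
  elim: (index_enum _) => [|i r [IH1 IH2]].
    by rewrite !big_nil dot0// mem0v.
  rewrite !big_cons lin ?cc_f_g1// IH2; split => //.
  by rewrite memvD// memvZ// cc_f_g1.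
rewrite dotl ?horizontal_part_g1//; apply: eq_bigr => i _; congr (_ * _).
rewrite sym ?horizontal_part_g1 ?cc_f_g1// dotl ?cc_f_g1//.
rewrite (bigD1 i)//= cc_f_orthonormal eqxx mulr1 big1 ?addr0// => j ji.
by rewrite cc_f_orthonormal (negbTE ji) mulr0.
Qed.

Lemma is_derive_dotp (x y : R -> 'rV[R]_m) (dx dy : 'rV[R]_m) t :
  (forall i, is_derive t 1 (fun s => x s 0 i) (dx 0 i)) ->
  (forall i, is_derive t 1 (fun s => y s 0 i) (dy 0 i)) ->
  is_derive t 1 (fun s => dotp (x s) (y s)) (dotp dx (y t) + dotp (x t) dy).
Proof.
move=> hx hy; rewrite /dotp -big_split; apply: is_derive_bigsum => i.
exact: is_derive_mul.
Qed.

Lemma is_derive_mulmx (B : 'M[R]_m) (x : R -> 'rV[R]_m) (dx : 'rV[R]_m) t :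
  (forall i, is_derive t 1 (fun s => x s 0 i) (dx 0 i)) ->
  (forall i, is_derive t 1 (fun s => (x s *m B) 0 i) ((dx *m B) 0 i)).
Proof.
move=> hx i; rewrite mxE; under eq_fun do rewrite mxE.
apply: is_derive_bigsum => j; have := is_derive_scale (B j i) (hx j).
by under eq_fun do rewrite mulrC; rewrite mulrC.
Qed.

(** With [gamma t] frozen, the coordinates of [gamma(t)^-1 gamma(s)] are affine in those of
    [gamma s]. The component of the velocity along [f_0] is thus the defect in the area equation,
    and horizontality means that it vanishes. *)
Lemma velocityE gamma t (u : 'rV[R]_m) w :
  (forall i, is_derive t 1 (fun s => xcoord (gamma s) 0 i) (u 0 i)) ->
  is_derive t 1 (fun s => zcoord (gamma s)) w ->
  differentiable_at gamma t /\
  velocity gamma t = horizontal_part u +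
    (w - 2^-1 * dotp (xcoord (gamma t) *m A) u) *: cc_f0 G.
Proof.
move=> hx hz.
have dS i : is_derive t 1 (left_translated gamma t (lift ord0 i)) (u 0 i).
  rewrite (_ : left_translated _ _ _ =
    fun s => xcoord (gamma s) 0 i + - xcoord (gamma t) 0 i); last first.
    by apply/funext => s; rewrite left_translatedS.
  by have := is_derive_add (hx i) (is_derive_cst (- xcoord (gamma t) 0 i) t 1); rewrite addr0.
have d0 : is_derive t 1 (left_translated gamma t ord0)
    (w - 2^-1 * dotp (xcoord (gamma t) *m A) u).
  rewrite (_ : left_translated _ _ _ =
    fun s => (zcoord (gamma s) + - zcoord (gamma t)) +
      - (2^-1 * dotp (xcoord (gamma t) *m A) (xcoord (gamma s)))); last first.
    by apply/funext => s; rewrite left_translated0.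
  have dc : forall i, is_derive t 1 (fun s : R => (xcoord (gamma t) *m A) 0 i) ((0 : 'rV[R]_m) 0 i).
    by move=> i; rewrite [X in is_derive _ _ _ X]mxE; exact: is_derive_cst.
  have := is_derive_add (is_derive_add hz (is_derive_cst (- zcoord (gamma t)) t 1))
    (is_derive_opp (is_derive_scale 2^-1 (is_derive_dotp dc hx))).
  by rewrite addr0 dotp0l add0r.
split.
  move=> i; case: (unliftP ord0 i) => [j|] ->; first by case: (dS j).
  by case: d0.
rewrite /velocity big_ord_recl addrC; congr (_ + _).
  apply: eq_bigr => i _; rewrite tnth_frameS derive1E; congr (_ *: _).
  by case: (dS i).
by rewrite tnth_frame0 derive1E; congr (_ *: _); case: d0.
Qed.

Lemma differentiable_at_coord gamma t : differentiable_at gamma t ->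
  exists (u : 'rV[R]_m) w, (forall i, is_derive t 1 (fun s => xcoord (gamma s) 0 i) (u 0 i)) /\
    is_derive t 1 (fun s => zcoord (gamma s)) w.
Proof.
move=> dg.
pose u : 'rV[R]_m := \row_i ('D_1 (left_translated gamma t (lift ord0 i)) t).
have hx i : is_derive t 1 (fun s => xcoord (gamma s) 0 i) (u 0 i).
  rewrite mxE; have d := derivableP (dg (lift ord0 i)).
  have := is_derive_add d (is_derive_cst (xcoord (gamma t) 0 i) t 1); rewrite addr0.
  rewrite [X in is_derive _ _ X _ -> _](_ : _ = fun s => xcoord (gamma s) 0 i)//.
  by apply/funext => s; rewrite left_translatedS subrK.
exists u, ('D_1 (left_translated gamma t ord0) t + 2^-1 * dotp (xcoord (gamma t) *m A) u).
split => //; have d := derivableP (dg ord0).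
have dc : forall i, is_derive t 1 (fun s : R => (xcoord (gamma t) *m A) 0 i) ((0 : 'rV[R]_m) 0 i).
  by move=> i; rewrite [X in is_derive _ _ _ X]mxE; exact: is_derive_cst.
have := is_derive_add (is_derive_add d (is_derive_cst (zcoord (gamma t)) t 1))
    (is_derive_scale 2^-1 (is_derive_dotp dc hx)).
rewrite addr0 dotp0l add0r.
rewrite [X in is_derive _ _ X _ -> _](_ : _ = fun s => zcoord (gamma s))//.
apply/funext => s; rewrite left_translated0; ring.
Qed.

Lemma ae_forall (I : finType) (P : I -> R -> Prop) :
  (forall i, {ae mu, forall t, P i t}) -> {ae mu, forall t, forall i, P i t}.
Proof.
move=> H; have : {ae mu, forall t, forall i, i \in index_enum I -> P i t}.
  elim: (index_enum I) => [|i r IH]; first by apply: aeW.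
  apply: ae_imply (ae_and (H i) IH) => t [Hi Hr] j.
  by rewrite inE => /orP[/eqP ->//|/Hr].
by apply: ae_imply => t + i; apply; rewrite mem_index_enum.
Qed.

(* [u] is a bounded Borel representative of the velocity. *)
Definition hcurve a b (x : R -> 'rV[R]_m) (z : R -> R) (u : R -> 'rV[R]_m) :=
  (forall i, lipschitz_derivative a b (fun t => x t 0 i) (fun t => u t 0 i)) /\
  lipschitz_derivative a b z (fun t => 2^-1 * dotp (x t *m A) (u t)).

Lemma bounded_measurable_mulmx a b (B : 'M[R]_m) (x : R -> 'rV[R]_m) :
  (forall i, bounded_measurable a b (fun t => x t 0 i)) ->
  forall i, bounded_measurable a b (fun t => (x t *m B) 0 i).
Proof.
move=> H i; under eq_fun do rewrite mxE.
apply: bounded_measurable_sum => j; apply: bounded_measurableM => //.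
exact: bounded_measurable_cst.
Qed.

Lemma bounded_measurable_dotp a b (x y : R -> 'rV[R]_m) :
  (forall i, bounded_measurable a b (fun t => x t 0 i)) ->
  (forall i, bounded_measurable a b (fun t => y t 0 i)) ->
  bounded_measurable a b (fun t => dotp (x t) (y t)).
Proof.
by move=> hx hy; apply: bounded_measurable_sum => i; exact: bounded_measurableM.
Qed.

Lemma lipschitz_derivative_bounded a b f f' : @lipschitz_derivative R a b f f' ->
  bounded_measurable a b f /\ bounded_measurable a b f'.
Proof. by move=> [[K fK] bf _]; split => //; exact: lipschitz_bounded_measurable fK. Qed.

Lemma xcoord_fun gamma i :
  (fun t => xcoord (gamma t) 0 i) = (fun t => ecoord (lift ord0 i) (gamma t)).
Proof. by apply/funext => t; rewrite mxE. Qed.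

(** The derivative of the height needs no representative of its own: horizontality identifies it
    almost everywhere with an expression in [x] and [u], which is already Borel and bounded. *)
Lemma horizontal_hcurve a b gamma : a < b -> horizontal a b gamma ->
  exists u, hcurve a b (fun t => xcoord (gamma t)) (fun t => zcoord (gamma t)) u.
Proof.
move=> ab [lip dif].
have lx i : exists K, lipschitz_with K a b (fun t => xcoord (gamma t) 0 i).
  by rewrite xcoord_fun; exact: (lipschitz_withP _ _ _).1 (lip (lift ord0 i)).
have lz : exists K, lipschitz_with K a b (fun t => zcoord (gamma t)).
  exact: (lipschitz_withP _ _ _).1 (lip ord0).
have ex i : exists ui, lipschitz_derivative a b (fun t => xcoord (gamma t) 0 i) ui.
  apply: lipschitz_derivative_ex => //.
  apply: ae_imply dif => t + tab => /(_ tab)[+ _].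
  by move=> /differentiable_at_coord[u [w [hu _]]]; case: (hu i).
have /boolp.choice[u hu] := ex.
pose v t : 'rV[R]_m := \row_i u i t.
have hv i : lipschitz_derivative a b (fun t => xcoord (gamma t) 0 i) (fun t => v t 0 i).
  by under [X in lipschitz_derivative _ _ _ X]eq_fun do rewrite mxE.
exists v; split => //; split => //.
  apply: bounded_measurableM; first exact: bounded_measurable_cst.
  apply: bounded_measurable_dotp => i.
    by apply: bounded_measurable_mulmx => j; case: (lipschitz_derivative_bounded (hv j)).
  by case: (lipschitz_derivative_bounded (hv i)).
have dx : {ae mu, forall t, forall i, a <= t <= b ->
    is_derive t 1 (fun s => xcoord (gamma s) 0 i) (v t 0 i)}.
  by apply: ae_forall => i; case: (hv i).
apply: ae_imply (ae_and dif dx) => t [D dv] tab.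
have [/differentiable_at_coord[_ [w [_ hw]]] vg1] := D tab.
have [_ E] := velocityE (fun i => dv i tab) hw.
by move: vg1; rewrite E mem_g1 subr_eq0 => /eqP <-.
Qed.

Lemma hcurve_velocity a b gamma u :
  hcurve a b (fun t => xcoord (gamma t)) (fun t => zcoord (gamma t)) u ->
  {ae mu, forall t, a <= t <= b ->
    differentiable_at gamma t /\ velocity gamma t = horizontal_part (u t)}.
Proof.
move=> [hx [_ _ hz]].
have dx : {ae mu, forall t, forall i, a <= t <= b ->
    is_derive t 1 (fun s => xcoord (gamma s) 0 i) (u t 0 i)}.
  by apply: ae_forall => i; case: (hx i).
apply: ae_imply (ae_and hz dx) => t [D dv] tab.
have [d E] := velocityE (fun i => dv i tab) (D tab).
by split => //; rewrite E subrr scale0r addr0.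
Qed.

Lemma hcurve_horizontal a b gamma u :
  hcurve a b (fun t => xcoord (gamma t)) (fun t => zcoord (gamma t)) u ->
  horizontal a b gamma.
Proof.
move=> H; split; last first.
  apply: ae_imply (hcurve_velocity H) => t + tab => /(_ tab)[d ->].
  by rewrite horizontal_part_g1.
case: H => hx [lz _ _] i; apply/lipschitz_withP.
case: (unliftP ord0 i) => [j|] -> //.
by have [+ _ _] := hx j; rewrite xcoord_fun.
Qed.

Lemma hcurve_energy a b gamma u :
  hcurve a b (fun t => xcoord (gamma t)) (fun t => zcoord (gamma t)) u ->
  energy a b gamma = (2^-1 * integral_cc a b (fun t => dotp (u t) (u t)))%:E.
Proof.
move=> H; rewrite /energy EFinM; congr (_ * _)%E.
rewrite (@ae_eq_integral_ge0 _ a b _ (fun t => dotp (u t) (u t))).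
- apply: integral_ccE; apply: bounded_measurable_dotp => i;
  by case: H => /(_ i) /lipschitz_derivative_bounded[].
- by move=> t; exact: dotp_ge0.
apply: ae_imply (hcurve_velocity H) => t + tab => /(_ tab)[_ ->].
exact: cc_dot_horizontal.
Qed.

End HorizontalCurves.

(** * The Euler-Lagrange equation *)

Ltac bounded_measurable_tac :=
  repeat first
    [ assumption
    | exact: bounded_measurable_cst
    | apply: bounded_measurableD
    | apply: bounded_measurableM
    | apply: bounded_measurableN
    | apply: bounded_measurable_dotp => ?
    | apply: bounded_measurable_mulmx => ?
    | match goal with H : forall i, bounded_measurable _ _ _ |- _ => exact: H end ].

Section LagrangeMultiplier.
Context {R : realType}.

(** If [c] were nonzero, a small [s] of the opposite sign would make the linear term outweigh the
    rest. *)
Lemma linear_coefficient_eq0 (c F0 F1 F2 delta : R) : 0 < delta ->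
  (forall s, `|s| <= delta -> 0 <= s * c + s ^+ 2 * (F0 + F1 * s + F2 * s ^+ 2)) ->
  c = 0.
Proof.
move=> delta0 H; apply: contrapT => /eqP c0.
pose M := `|F0| + `|F1| + `|F2|.
have M0 : 0 <= M by rewrite !addr_ge0.
(* At [|s| = e] the linear term is [- e |c|], at most [- e^2 (M + 1)], while the remainder is at
   most [e^2 M] because [e <= 1]. *)
pose e := Num.min delta (Num.min 1 (`|c| / (M + 1))).
have cM : 0 < `|c| / (M + 1) by rewrite divr_gt0 ?normr_gt0// ltr_wpDl.
have e0 : 0 < e by rewrite !lt_min delta0 ltr01.
have e1 : e <= 1 by rewrite !ge_min lexx orbT.
have eM : e * (M + 1) <= `|c|.
  by rewrite -ler_pdivlMr ?ltr_wpDl// !ge_min lexx !orbT.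
have := H (- (Num.sg c) * e).
have sg1 : `|Num.sg c| = 1 by rewrite normr_sg c0.
rewrite normrM normrN sg1 mul1r (ger0_norm (ltW e0)) ge_min lexx => /(_ isT).
rewrite exprMn sqrrN sqr_sg c0 mul1r => H1.
have B : F0 + F1 * (- Num.sg c * e) + F2 * e ^+ 2 <= M.
  apply: lerD; first apply: lerD; rewrite ?ler_norm//.
    rewrite (le_trans (ler_norm _))// normrM normrM normrN sg1 mul1r (ger0_norm (ltW e0)).
    by rewrite ler_piMr.
  rewrite (le_trans (ler_norm _))// normrM ler_piMr// ger0_norm ?sqr_ge0//.
  by rewrite expr_le1// ltW.
have E1 : - Num.sg c * e * c = - (e * `|c|) by rewrite normrEsg; ring.
move: H1; rewrite E1; move: B; set X := (_ + _ + _).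
have : e * (e * (M + 1)) <= e * `|c| by rewrite ler_wpM2l// ltW.
have : 0 < e ^+ 2 by rewrite exprn_gt0.
move=> h1 h2 h3 h4.
have : e ^+ 2 * X <= e ^+ 2 * M by rewrite ler_wpM2l// ltW.
move: h2; rewrite mulrA -expr2; nra.
Qed.

(** The constraint is solved exactly by [r = - l1 s / (l2 + q s)]. Multiplying the inequality by the
    square of the denominator leaves a polynomial in [s] without constant term, whose linear
    coefficient must vanish. *)
Lemma lagrange_multiplier (l1 l2 q e1 e2 n1 n12 n2 : R) : l2 != 0 ->
  (forall s r, s * l1 + r * l2 + s * r * q = 0 ->
     0 <= 2 * (s * e1 + r * e2) + (s ^+ 2 * n1 + 2 * (s * r) * n12 + r ^+ 2 * n2)) ->
  e1 = e2 / l2 * l1.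
Proof.
move=> l20 H.
pose E0 := n1 * l2 ^+ 2 - 2 * l1 * n12 * l2 + l1 ^+ 2 * n2.
pose E1 := n1 * 2 * l2 * q - 2 * l1 * n12 * q.
pose E2 := n1 * q ^+ 2.
have q0 : 0 < `|q| + 1 by rewrite ltr_wpDl.
(* For [|s|] up to this value, [|q s|] is at most [|l2| / 2], so the denominator [l2 + q s] stays
   nonzero. *)
have d0 : 0 < `|l2| / 2 / (`|q| + 1) by rewrite !divr_gt0// normr_gt0.
have C : 2 * l2 * (e1 * l2 - l1 * e2) = 0.
  apply: (@linear_coefficient_eq0 _ (4 * e1 * l2 * q - 2 * l1 * e2 * q + E0)
    (2 * e1 * q ^+ 2 + E1) E2 _ d0) => s sd.
  pose D := l2 + q * s.
  have D0 : D != 0.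
    apply/eqP => D0; have : `|l2| = `|q * s|.
      by rewrite -normrN; congr `|_|; move: D0; rewrite /D; lra.
    rewrite normrM => E.
    have : `|q| * `|s| <= (`|q| + 1) * (`|l2| / 2 / (`|q| + 1)).
      by rewrite ler_pM// lerDl.
    rewrite [leRHS]mulrC mulfVK ?gt_eqF// -E.
    have : 0 < `|l2| by rewrite normr_gt0.
    lra.
  have := H s (- (l1 * s) / D).
  have -> : s * l1 + - (l1 * s) / D * l2 + s * (- (l1 * s) / D) * q = 0.
    by rewrite /D; field; rewrite -/D.
  move=> /(_ erefl) H1.
  have : 0 <= D ^+ 2 * (2 * (s * e1 + - (l1 * s) / D * e2) +
     (s ^+ 2 * n1 + 2 * (s * (- (l1 * s) / D)) * n12 + (- (l1 * s) / D) ^+ 2 * n2)).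
    by rewrite mulr_ge0// sqr_ge0.
  congr (0 <= _); rewrite /E0 /E1 /E2 /D; field.
  by rewrite -/D.
have : e1 * l2 = l1 * e2.
  apply/eqP; rewrite -subr_eq0; move/eqP: C; rewrite mulf_eq0 mulf_eq0.
  by rewrite (negbTE l20) pnatr_eq0.
by move=> E; rewrite mulrAC -[e2 * l1]mulrC -E mulfK.
Qed.

End LagrangeMultiplier.

Section EulerLagrange.
Context {R : realType} {n : nat} {G : contactCarnot R n}.
Local Notation m := (2 * n)%N.
Local Notation A := (cc_A G).
Local Notation mu := (@lebesgue_measure R).
Implicit Types (a b t : R) (x y u v d : R -> 'rV[R]_m) (z w : R -> R).

Lemma ae_dense (P : R -> Prop) s t : {ae mu, forall r, P r} -> s < t ->
  exists2 r, s < r < t & P r.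
Proof.
move=> [N [mN N0 HN]] st; apply: contrapT => H.
have sub : `]s, t[ `<=` N.
  move=> r /=; rewrite in_itv/= => str; apply: HN => /= Pr.
  by apply: H; exists r.
have : (mu `]s, t[ <= mu N)%E by apply: le_measure => //; rewrite inE.
rewrite N0 lebesgue_measure_itv/= lte_fin st -EFinB lee_fin; lra.
Qed.

(** Points where the value is [c] accumulate at [t] from the right; this is why [t = b] is left
    out. *)
Lemma lipschitz_ae_cst K a b (f : R -> R) c : a < b -> lipschitz_with K a b f ->
  {ae mu, forall t, a <= t <= b -> f t = c} -> forall t, a <= t < b -> f t = c.
Proof.
move=> ab fK fc t /andP[at_ tb].
apply/eqP; rewrite -subr_eq0 -normr_le0; apply/ler_addgt0Pl => e e0; rewrite addr0.
pose d := Num.min (b - t) (e / (`|K| + 1)).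
have K0 : 0 < `|K| + 1 by rewrite ltr_wpDl.
have d0 : 0 < d by rewrite lt_min subr_gt0 tb divr_gt0.
have [|r /andP[tr rd] /(_ _) rc] := @ae_dense _ t (t + d) fc; first by rewrite ltrDl.
have db : d <= b - t by rewrite ge_min lexx.
have de : d <= e / (`|K| + 1) by rewrite ge_min lexx orbT.
have rab : a <= r <= b by apply/andP; split; lra.
rewrite -(rc rab) (le_trans (fK _ _ _ rab)) ?at_ ?(ltW tb)//.
rewrite (@le_trans _ _ ((`|K| + 1) * `|t - r|))//.
  by rewrite ler_wpM2r// (le_trans (ler_norm K))// lerDl.
rewrite -ler_pdivlMl// mulrC distrC gtr0_norm ?subr_gt0//.
by rewrite (le_trans _ de)// lerBlDl ltW.
Qed.

(** The gain of regularity: by the fundamental theorem [f] is a primitive of the continuous function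
    [h], hence differentiable at every interior point and not merely at almost every one. *)
Lemma lipschitz_derivative_continuous a b (f g h : R -> R) : a < b ->
  lipschitz_derivative a b f g -> {within `[a, b], continuous h} ->
  {ae mu, forall t, a <= t <= b -> g t = h t} ->
  forall t, a < t < b -> is_derive t 1 f (h t).
Proof.
move=> ab fg ch gh t /andP[at_ tb].
have bh := continuous_bounded_measurable ch.
have ih := bounded_measurable_integrable bh.
have fE s : a < s < b -> f s = f a + integral_cc a s h.
  move=> /andP[as_ sb].
  have fg' : lipschitz_derivative a s f g by apply: lipschitz_derivativeS fg => //; exact: ltW.
  have bh' : bounded_measurable a s h by apply: bounded_measurableS bh => //; exact: ltW.
  rewrite -(@ae_eq_integral_cc _ a s g h)//.
  - by rewrite (lipschitz_FTC as_ fg') addrC subrK.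
  - by case: fg'.
  - apply: ae_imply gh => r + /andP[ar rs]; apply.
    by rewrite ar (le_trans rs (ltW sb)).
have ct : {for t, continuous h}.
  have /(continuous_within_itvP _ ab)[+ _ _] := ch; apply.
  by rewrite in_itv/= at_.
have [dF eF] := continuous_FTC1_closed tb ih at_ ct.
have dF' : is_derive t 1 (fun s => integral_cc a s h) (h t).
  by apply: DeriveDef; [exact: dF | rewrite -derive1E eF].
have := is_derive_add (is_derive_cst (f a) t 1) dF'; rewrite add0r.
apply: near_eq_is_derive.
near=> s; rewrite /= (fE s)//; apply/andP; split.
  by near: s; exact: lt_nbhsr.
by near: s; exact: lt_nbhsl.
Unshelve. all: by end_near. Qed.

Definition coord_minimizing a b x z u :=
  forall y w v, hcurve (G := G) a b y w v -> y a = x a -> y b = x b ->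
    w a = z a -> w b = z b ->
    integral_cc a b (fun t => dotp (u t) (u t)) <=
    integral_cc a b (fun t => dotp (v t) (v t)).

Lemma energy_minimizing_coord a b (gamma : R -> G) u :
  hcurve (G := G) a b (fun t => xcoord (gamma t)) (fun t => zcoord (gamma t)) u ->
  energy_minimizing a b gamma ->
  coord_minimizing a b (fun t => xcoord (gamma t)) (fun t => zcoord (gamma t)) u.
Proof.
move=> hg mg y w v hy ya yb wa wb.
pose eta t : G := ecoords (y t) (w t).
have he : hcurve (G := G) a b (fun t => xcoord (eta t)) (fun t => zcoord (eta t)) v.
  have -> : (fun t => xcoord (eta t)) = y by apply/funext => t; rewrite xcoordE.
  by have -> : (fun t => zcoord (eta t)) = w by apply/funext => t; rewrite zcoordE.
have := mg eta (hcurve_horizontal he).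
rewrite /eta ya yb wa wb !ecoordsK => /(_ erefl erefl).
rewrite (hcurve_energy hg) (hcurve_energy he) lee_fin.
by rewrite ler_pM2l// invr_gt0.
Qed.

Lemma coord_energy_minimizing a b (gamma : R -> G) u : a < b ->
  hcurve (G := G) a b (fun t => xcoord (gamma t)) (fun t => zcoord (gamma t)) u ->
  coord_minimizing a b (fun t => xcoord (gamma t)) (fun t => zcoord (gamma t)) u ->
  energy_minimizing a b gamma.
Proof.
move=> ab hg mg eta /(horizontal_hcurve ab)[v he] ea eb.
rewrite (hcurve_energy hg) (hcurve_energy he) lee_fin ler_pM2l ?invr_gt0//.
by apply: mg he _ _ _ _; rewrite ?ea ?eb.
Qed.

Section Variation.
Variables (a b : R) (x : R -> 'rV[R]_m) (z : R -> R) (u : R -> 'rV[R]_m).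
Hypothesis ab : a < b.
Hypothesis hc : hcurve (G := G) a b x z u.
Hypothesis min : coord_minimizing a b x z u.

Let bx i : bounded_measurable a b (fun t => x t 0 i).
Proof. by case: hc => /(_ i) /lipschitz_derivative_bounded[]. Qed.

Let bu i : bounded_measurable a b (fun t => u t 0 i).
Proof. by case: hc => /(_ i) /lipschitz_derivative_bounded[]. Qed.

Lemma lipschitz_derivative_mulmx (B : 'M[R]_m) y v :
  (forall i, lipschitz_derivative a b (fun t => y t 0 i) (fun t => v t 0 i)) ->
  (forall i, lipschitz_derivative a b (fun t => (y t *m B) 0 i) (fun t => (v t *m B) 0 i)).
Proof.
move=> H i; under eq_fun do rewrite mxE.
under [X in lipschitz_derivative _ _ _ X]eq_fun do rewrite mxE.
apply: lipschitz_derivative_sum => j; have := lipschitz_derivativeZ (B j i) (H j).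
under eq_fun do rewrite mulrC.
by under [X in lipschitz_derivative _ _ _ X]eq_fun do rewrite mulrC.
Qed.

Lemma lipschitz_derivative_dotp y v y' v' :
  (forall i, lipschitz_derivative a b (fun t => y t 0 i) (fun t => y' t 0 i)) ->
  (forall i, lipschitz_derivative a b (fun t => v t 0 i) (fun t => v' t 0 i)) ->
  lipschitz_derivative a b (fun t => dotp (y t) (v t))
    (fun t => dotp (y' t) (v t) + dotp (y t) (v' t)).
Proof.
move=> hy hv; rewrite /dotp.
under [X in lipschitz_derivative _ _ _ X]eq_fun do rewrite -big_split.
by apply: lipschitz_derivative_sum => i; exact: lipschitz_derivativeM.
Qed.

(** The competitor is [x + d] with the height rebuilt from its area. The integral condition says
    that the end height is unchanged, and the conclusion is the expansion of the energy
    difference. *)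
Lemma variation_ineq d d' :
  (forall i, lipschitz_derivative a b (fun t => d t 0 i) (fun t => d' t 0 i)) ->
  d a = 0 -> d b = 0 ->
  integral_cc a b (fun t => dotp (d t *m A) (u t)) +
    2^-1 * integral_cc a b (fun t => dotp (d t *m A) (d' t)) = 0 ->
  0 <= 2 * integral_cc a b (fun t => dotp (u t) (d' t)) +
       integral_cc a b (fun t => dotp (d' t) (d' t)).
Proof.
move=> hd da db C.
have bd i : bounded_measurable a b (fun t => d t 0 i).
  by case: (lipschitz_derivative_bounded (hd i)).
have bd' i : bounded_measurable a b (fun t => d' t 0 i).
  by case: (lipschitz_derivative_bounded (hd i)).
have [hx hz] := hc.
pose y t := x t + d t; pose v t := u t + d' t.
have hy i : lipschitz_derivative a b (fun t => y t 0 i) (fun t => v t 0 i).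
  have := lipschitz_derivativeD (hx i) (hd i).
  rewrite (_ : (fun t => x t 0 i + d t 0 i) = fun t => y t 0 i); last first.
    by apply/funext => t; rewrite mxE.
  by rewrite (_ : (fun t => u t 0 i + d' t 0 i) = fun t => v t 0 i)//;
    apply/funext => t; rewrite mxE.
have by_ i : bounded_measurable a b (fun t => y t 0 i).
  by case: (lipschitz_derivative_bounded (hy i)).
have bv i : bounded_measurable a b (fun t => v t 0 i).
  by case: (lipschitz_derivative_bounded (hy i)).
pose g t := 2^-1 * dotp (y t *m A) (v t).
have bg : bounded_measurable a b g by bounded_measurable_tac.
pose w t := z a + primitive a b g t.
have hw : lipschitz_derivative a b w g.
  have := lipschitz_derivativeD (lipschitz_derivative_cst a b (z a)) (primitive_derivative ab bg).
  by under [X in lipschitz_derivative _ _ _ X]eq_fun do rewrite add0r.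
(* By parts, with [d] vanishing at both ends and [A] skew, the two terms of the area that are linear
   in [d] agree; this cancels the factor 1/2 of the linear part. *)
have parts : integral_cc a b (fun t => dotp (x t *m A) (d' t)) =
    integral_cc a b (fun t => dotp (d t *m A) (u t)).
  have H := lipschitz_FTC ab (lipschitz_derivative_dotp (lipschitz_derivative_mulmx A hx) hd).
  move: H; rewrite da db !dotp0r subrr integral_ccD; try by bounded_measurable_tac.
  under eq_fun do rewrite area_skew -mulN1r.
  by rewrite integral_ccZ ?mulN1r; [lra | bounded_measurable_tac].
have wb : w b = z b.
  have Hw := lipschitz_FTC ab hw; have Hz := lipschitz_FTC ab hz.
  have wa : w a = z a by rewrite /w primitive_left addr0.
  suff E : integral_cc a b g = integral_cc a b (fun t => 2^-1 * dotp (x t *m A) (u t)).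
    by move: E; rewrite Hw Hz wa => /addIr.
  have -> : g = (fun t => 2^-1 * dotp (x t *m A) (u t) +
      (2^-1 * dotp (d t *m A) (u t) + (2^-1 * dotp (x t *m A) (d' t) +
       2^-1 * dotp (d t *m A) (d' t)))).
    apply/funext => t; rewrite /g /y /v mulmxDl dotpDl !dotpDr; ring.
  rewrite !integral_ccD; try by bounded_measurable_tac.
  rewrite [X in X + _]integral_ccZ; last by bounded_measurable_tac.
  rewrite [X in _ + (X + _)]integral_ccZ; last by bounded_measurable_tac.
  rewrite [X in _ + (_ + (X + _))]integral_ccZ; last by bounded_measurable_tac.
  rewrite [X in _ + (_ + (_ + X))]integral_ccZ; last by bounded_measurable_tac.
  rewrite integral_ccZ; last by bounded_measurable_tac.
  rewrite parts; lra.
have := min (conj hy hw).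
rewrite /y da db !addr0 {1}/w primitive_left addr0 => /(_ erefl erefl erefl wb).
have -> : (fun t => dotp (v t) (v t)) = (fun t => dotp (u t) (u t) +
    (2 * dotp (u t) (d' t) + dotp (d' t) (d' t))).
  by apply/funext => t; rewrite /v dotpDl !dotpDr (dotpC (d' t) (u t)); ring.
rewrite !integral_ccD; try by bounded_measurable_tac.
rewrite integral_ccZ; last by bounded_measurable_tac.
by rewrite lerDl.
Qed.

(* Variations in a fixed direction sweep no area, so the constraint has no square terms
   and can be solved for [r] explicitly. *)
Lemma variation2_ineq (f f' g g' : R -> R) i j (s r : R) :
  lipschitz_derivative a b f f' -> f a = 0 -> f b = 0 ->
  lipschitz_derivative a b g g' -> g a = 0 -> g b = 0 ->
  let l h k := integral_cc a b (fun t => h t * dotp (delta_mx 0 k *m A) (u t)) in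
  let e h k := integral_cc a b (fun t => h t * u t 0 k) in
  let q := 2^-1 * integral_cc a b (fun t => f t * g' t * A i j + g t * f' t * A j i) in
  s * l f i + r * l g j + s * r * q = 0 ->
  0 <= 2 * (s * e f' i + r * e g' j) +
    (s ^+ 2 * integral_cc a b (fun t => f' t ^+ 2) +
     2 * (s * r) * ((i == j)%:R * integral_cc a b (fun t => f' t * g' t)) +
     r ^+ 2 * integral_cc a b (fun t => g' t ^+ 2)).
Proof.
move=> hf fa fb hg ga gb l e q C.
have [bf bf'] := lipschitz_derivative_bounded hf.
have [bg bg'] := lipschitz_derivative_bounded hg.
pose d t : 'rV[R]_m := (s * f t) *: delta_mx 0 i + (r * g t) *: delta_mx 0 j.
pose d' t : 'rV[R]_m := (s * f' t) *: delta_mx 0 i + (r * g' t) *: delta_mx 0 j.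
have hd k : lipschitz_derivative a b (fun t => d t 0 k) (fun t => d' t 0 k).
  have := lipschitz_derivativeD (lipschitz_derivativeZ (s * (delta_mx 0 i : 'rV[R]_m) 0 k) hf)
    (lipschitz_derivativeZ (r * (delta_mx 0 j : 'rV[R]_m) 0 k) hg).
  rewrite (_ : (fun t => _ + _) = fun t => d t 0 k); last first.
    apply/funext => t; rewrite /d [RHS]mxE [X in _ = X + _]mxE [X in _ = _ + X]mxE.
    by rewrite (mulrAC s) (mulrAC r).
  rewrite (_ : (fun t => _ + _) = fun t => d' t 0 k)//.
  apply/funext => t; rewrite /d' [RHS]mxE [X in _ = X + _]mxE [X in _ = _ + X]mxE.
  by rewrite (mulrAC s) (mulrAC r).
have da : d a = 0 by rewrite /d fa ga !mulr0 !scale0r addr0.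
have db : d b = 0 by rewrite /d fb gb !mulr0 !scale0r addr0.
have Aij k h : dotp (delta_mx 0 k *m A) (delta_mx 0 h) = A k h.
  by rewrite dotpC dotp_delta -rowE mxE.
have area_d (y : 'rV[R]_m) t : dotp (d t *m A) y = s * (f t * dotp (delta_mx 0 i *m A) y) +
    r * (g t * dotp (delta_mx 0 j *m A) y).
  by rewrite /d mulmxDl -!scalemxAl dotpDl !dotpZl !mulrA.
have {}C : integral_cc a b (fun t => dotp (d t *m A) (u t)) +
    2^-1 * integral_cc a b (fun t => dotp (d t *m A) (d' t)) = 0.
  rewrite -[RHS]C; congr (_ + _).
    under eq_fun do rewrite area_d.
    rewrite integral_ccD; try by bounded_measurable_tac.
    by rewrite !integral_ccZ//; bounded_measurable_tac.
  rewrite /q mulrCA; congr (_ * _).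
  rewrite -integral_ccZ; last by bounded_measurable_tac.
  congr integral_cc; apply/funext => t; rewrite area_d /d' !dotpDr !dotpZr !Aij.
  rewrite -[A i i]Aij -[A j j]Aij !area_diag; ring.
have := variation_ineq hd da db C.
congr (0 <= 2 * _ + _).
  have -> : (fun t => dotp (u t) (d' t)) =
      (fun t => s * (f' t * u t 0 i) + r * (g' t * u t 0 j)).
    apply/funext => t; rewrite /d' dotpDr !dotpZr !(dotpC (u t)) !dotp_delta.
    by rewrite !mulrA.
  rewrite integral_ccD; try by bounded_measurable_tac.
  by rewrite !integral_ccZ//; bounded_measurable_tac.
have -> : (fun t => dotp (d' t) (d' t)) =
    (fun t => s ^+ 2 * (f' t * f' t) + (2 * (s * r) * (i == j)%:R * (f' t * g' t) +
     r ^+ 2 * (g' t * g' t))).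
  apply/funext => t; rewrite /d' !dotpDl !dotpDr !dotpZl !dotpZr !dotp_delta !mxE.
  rewrite !eqxx/= (eq_sym j i) mulr1n; ring.
rewrite !integral_ccD; try by bounded_measurable_tac.
rewrite !integral_ccZ; try by bounded_measurable_tac.
by rewrite -!mulrA addrA.
Qed.

(** One bump [g] in direction [j] that changes the height to first order is fixed as the
    compensating one; all other bumps are tested against it, so that [lam] does not depend on the
    direction [i]. *)
Lemma euler_lagrange : exists (lam : R) (c : 'rV[R]_m), forall t, a < t < b ->
  forall i, is_derive t 1 (fun s => x s 0 i) ((c + lam *: (x t *m A)) 0 i).
Proof.
have [hx _] := hc.
have hxA := lipschitz_derivative_mulmx A hx.
pose l h k := integral_cc a b (fun t => h t * dotp (delta_mx 0 k *m A) (u t)).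
(* By parts the first variation of the height, like that of the energy, is tested by [f'], which is
   the form that [duBois_Reymond] takes. *)
have lE f f' i : lipschitz_derivative a b f f' -> f a = 0 -> f b = 0 ->
    l f i = integral_cc a b (fun t => f' t * (x t *m A) 0 i).
  move=> hf fa fb; have [bf bf'] := lipschitz_derivative_bounded hf.
  have := lipschitz_FTC ab (lipschitz_derivativeM hf (hxA i)).
  rewrite fa fb !mul0r subrr integral_ccD; try by bounded_measurable_tac.
  have -> : (fun t => f t * (u t *m A) 0 i) =
      (fun t => -1 * (f t * dotp (delta_mx 0 i *m A) (u t))).
    by apply/funext => t; rewrite area_skew dotpC dotp_delta; ring.
  by rewrite integral_ccZ; [rewrite /l; lra | bounded_measurable_tac].
have xA_lip i : exists K, lipschitz_with K a b (fun t => (x t *m A) 0 i).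
  by case: (hxA i).
have [[g [g' [j [[hg ga gb] lg]]]]|no] :=
  pselect (exists g g' j, [/\ lipschitz_derivative a b g g', g a = 0 & g b = 0]
    /\ l g j != 0); last first.
  (* The degenerate case: no bump changes the height to first order, so [x A] is constant. As [A] is
     invertible, [x] is constant, and zero serves for both [lam] and [c]. *)
  have ex i : exists ci, forall t, a <= t < b -> (x t *m A) 0 i = ci.
    have [|f f' hf fa fb|ci Hci] := @duBois_Reymond _ a b (fun t => (x t *m A) 0 i) ab.
    - by bounded_measurable_tac.
    - rewrite -(lE f)//; apply/eqP/negP => /negP lf; apply: no.
      by exists f, f', i.
    - by have [K LK] := xA_lip i; exists ci; exact: lipschitz_ae_cst ab LK Hci.
  have /boolp.choice[c Hc] := ex.
  exists 0, 0 => t /andP[at_ tb] i; rewrite scale0r addr0 mxE.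
  have := is_derive_cst ((\row_i c i *m invmx A) 0 i) t 1.
  apply: near_eq_is_derive; near=> s.
  suff -> : x s = \row_i c i *m invmx A by [].
  apply: (can_inj (mulmxK (cc_A_unit G))); rewrite mulmxKV ?cc_A_unit//.
  apply/rowP => k; rewrite [RHS]mxE; apply: Hc; apply/andP; split.
    by apply: ltW; near: s; exact: lt_nbhsr.
  by near: s; exact: lt_nbhsl.
have [bg bg'] := lipschitz_derivative_bounded hg.
pose lam := integral_cc a b (fun t => g' t * u t 0 j) / l g j.
exists lam.
have ex i : exists ci, {ae mu, forall t, a <= t <= b ->
    u t 0 i - lam * (x t *m A) 0 i = ci}.
  apply: duBois_Reymond => //; first by bounded_measurable_tac.
  move=> f f' hf fa fb; have [bf bf'] := lipschitz_derivative_bounded hf.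
  have E : integral_cc a b (fun t => f' t * u t 0 i) = lam * l f i.
    by apply: lagrange_multiplier lg _ => s r; exact: variation2_ineq.
  have -> : (fun t => f' t * (u t 0 i - lam * (x t *m A) 0 i)) =
      (fun t => f' t * u t 0 i + - lam * (f' t * (x t *m A) 0 i)).
    by apply/funext => t; ring.
  rewrite integral_ccD; try by bounded_measurable_tac.
  rewrite integral_ccZ; last by bounded_measurable_tac.
  by rewrite E (lE f f')// mulNr subrr.
have /boolp.choice[c Hc] := ex.
exists (\row_i c i) => t tab i.
apply: (@lipschitz_derivative_continuous a b _ _
  (fun s => (\row_i c i + lam *: (x s *m A)) 0 i) ab (hx i)) tab; last first.
  apply: ae_imply (Hc i) => s + sab => /(_ sab) E.
  by rewrite [RHS]mxE [X in _ = X + _]mxE -E [X in _ = _ + X]mxE subrK.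
have [[K LK] _ _] := lipschitz_derivativeD (lipschitz_derivative_cst a b (c i))
  (lipschitz_derivativeZ lam (hxA i)).
rewrite (_ : (fun s => (\row_i c i + lam *: (x s *m A)) 0 i) =
  (fun s => c i + lam * (x s *m A) 0 i)); first exact: lipschitz_continuous_cc LK.
by apply/funext => s; rewrite [LHS]mxE [X in X + _]mxE [X in _ + X]mxE.
Unshelve. all: by end_near. Qed.

End Variation.
End EulerLagrange.

(** * Extremals *)

Section Extremals.
Context {R : realType} {n : nat} {G : contactCarnot R n}.
Local Notation m := (2 * n)%N.
Local Notation A := (cc_A G).
Implicit Types (a b r s t lam : R) (x : R -> 'rV[R]_m) (c : 'rV[R]_m).

Definition momentum lam c x t : 'rV[R]_m := c + lam *: (x t *m A).

Definition extremal_on a b lam c x := forall t, a < t < b ->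
  forall i, is_derive t 1 (fun s => x s 0 i) (momentum lam c x t 0 i).

Lemma is_derive0_oo a b (f : R -> R) : (forall t, a < t < b -> is_derive t 1 f 0) ->
  forall s t, a < s < b -> a < t < b -> f s = f t.
Proof.
move=> df.
have main s t : a < s < b -> a < t < b -> s < t -> f s = f t.
  move=> /andP[as_ sb] /andP[at_ tb] st.
  have sub r : r \in `[s, t] -> is_derive r 1 f 0.
    rewrite in_itv/= => /andP[sr rt]; apply: df.
    by rewrite (lt_le_trans as_ sr) (le_lt_trans rt tb).
  have d0 r : r \in `]s, t[ -> is_derive r 1 f (cst 0 r).
    move=> rst; apply: sub; move: rst; rewrite !in_itv/= => /andP[sr rt].
    by rewrite !ltW.
  have cf : {within `[s, t], continuous f}.
    by apply: derivable_within_continuous => r /sub[].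
  have [r _] := MVT st d0 cf.
  by rewrite mul0r => /eqP; rewrite subr_eq0 => /eqP.
move=> s t sab tab; case: (ltgtP s t) => [st|ts|->//]; first exact: main.
by apply/esym/main.
Qed.

Lemma momentum_derive lam c x t :
  (forall i, is_derive t 1 (fun s => x s 0 i) (momentum lam c x t 0 i)) ->
  forall i, is_derive t 1 (fun s => momentum lam c x s 0 i)
    ((lam *: (momentum lam c x t *m A)) 0 i).
Proof.
move=> hx i.
have := is_derive_add (is_derive_cst (c 0 i) t 1)
  (is_derive_scale lam (is_derive_mulmx A hx i)).
rewrite add0r [X in _ -> is_derive _ _ _ X]mxE.
rewrite (_ : (fun s => momentum lam c x s 0 i) =
  (fun s => cst (c 0 i) s + lam * (x s *m A) 0 i))//.
by apply/funext => s; rewrite /momentum [LHS]mxE; congr (_ + _); rewrite mxE.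
Qed.

Lemma momentum_norm a b lam c x : extremal_on a b lam c x ->
  forall s t, a < s < b -> a < t < b ->
  dotp (momentum lam c x s) (momentum lam c x s) =
  dotp (momentum lam c x t) (momentum lam c x t).
Proof.
move=> hx; apply: is_derive0_oo => t tab.
have d := momentum_derive (hx t tab).
have := is_derive_dotp d d.
by rewrite (dotpC (momentum _ _ _ _)) dotpZl area_diag mulr0 addr0.
Qed.

Lemma extremal_stationary a b lam c x t0 : extremal_on a b lam c x ->
  a < t0 < b -> momentum lam c x t0 = 0 ->
  forall t, a < t < b -> momentum lam c x t = 0.
Proof.
move=> hx t0ab y0 t tab; apply/eqP; rewrite -dotp_eq0.
by rewrite (momentum_norm hx tab t0ab) y0 dotp0l.
Qed.

(** Both right-hand sides are the derivative of [x] on the overlap, so they agree there. Equal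
    multipliers force equal constants; different ones force the curve to stand still, first on the
    overlap and then on both intervals. *)
Lemma extremal_merge a r s b lam1 c1 lam2 c2 x : a <= r -> r < s -> s <= b ->
  extremal_on a s lam1 c1 x -> extremal_on r b lam2 c2 x ->
  exists lam c, extremal_on a b lam c x.
Proof.
move=> ar rs sb h1 h2.
have union lam c : (forall t, a < t < s -> momentum lam1 c1 x t = momentum lam c x t) ->
    (forall t, r < t < b -> momentum lam2 c2 x t = momentum lam c x t) ->
    extremal_on a b lam c x.
  move=> e1 e2 t /andP[at_ tb] i; case: (ltP t s) => ts.
    by rewrite -e1 ?at_//; apply: h1; rewrite at_.
  have rt := lt_le_trans rs ts.
  by rewrite -e2 ?rt//; apply: h2; rewrite rt.
have eq12 t : r < t < s -> momentum lam1 c1 x t = momentum lam2 c2 x t.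
  move=> /andP[rt ts]; apply/rowP => i.
  have [|_ <-] := h1 t _ i; first by rewrite (le_lt_trans ar rt).
  by have [|_ <-] := h2 t _ i; first by rewrite rt (lt_le_trans ts sb).
pose t0 := (r + s) / 2.
have t0rs : r < t0 < s by rewrite /t0; apply/andP; split; lra.
have t0as : a < t0 < s by case/andP: t0rs => rt ->; rewrite (le_lt_trans ar rt).
have t0rb : r < t0 < b by case/andP: t0rs => -> ts; rewrite (lt_le_trans ts sb).
have [ll|ll] := eqVneq lam1 lam2.
  exists lam1, c1; apply: union => // t _; move: (eq12 _ t0rs).
  by rewrite /momentum ll => /addIr ->.
(* Subtracting the two equations makes [x A] constant on the overlap. Its derivative, the momentum
   times [A], vanishes at [t0], and so does the momentum. *)
have xA t : r < t < s -> x t *m A = (lam1 - lam2)^-1 *: (c2 - c1).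
  move=> trs; have := eq12 t trs; rewrite /momentum => E.
  have : (lam1 - lam2) *: (x t *m A) = c2 - c1.
    by rewrite scalerBl -[lam1 *: _](addKr c1) E addrA addrK addrC.
  by move=> <-; rewrite scalerA mulVf ?scale1r// subr_eq0.
have y0 : momentum lam1 c1 x t0 = 0.
  suff : momentum lam1 c1 x t0 *m A = 0.
    move=> /(congr1 (fun M => M *m invmx A)).
    by rewrite mulmxK ?mul0mx// cc_A_unit.
  apply/rowP => i; have [_ <-] := is_derive_mulmx A (h1 t0 t0as) i.
  rewrite mxE; have [_ <-] := is_derive_cst ((x t0 *m A) 0 i) t0 (1 : R).
  apply: near_eq_derive; have /andP[rt0 t0s] := t0rs; near=> t.
  rewrite /= !xA//.
  apply/andP; split; first by near: t; exact: lt_nbhsr.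
  by near: t; exact: lt_nbhsl.
exists 0, 0; apply: union => t trs; rewrite [RHS]/momentum scale0r addr0.
  exact: extremal_stationary h1 t0as y0 _ trs.
apply: (extremal_stationary h2 t0rb _ trs).
by rewrite -eq12.
Unshelve. all: by end_near. Qed.

(** Continuous induction: the interval around the supremum of the reachable times is merged with an
    earlier one and would reach beyond the supremum, unless the supremum is 1. *)
Lemma extremal_global x :
  (forall t, 0 <= t <= 1 -> exists2 e, 0 < e & exists lam c,
     extremal_on (Num.max 0 (t - e)) (Num.min 1 (t + e)) lam c x) ->
  exists lam c, extremal_on 0 1 lam c x.
Proof.
move=> loc.
pose S : set R := [set s | 0 < s <= 1 /\ exists lam c, extremal_on 0 s lam c x].
have [e0 e00 [l0 [c0 h0]]] := loc 0 (introT andP (conj (lexx 0) ler01)).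
have S0 : S (Num.min 1 e0).
  split; first by rewrite lt_min ltr01 e00 ge_min lexx.
  by exists l0, c0; move: h0; rewrite sub0r add0r max_l// oppr_le0 ltW.
have ubS : ubound S 1 by move=> s [/andP[]].
have supS : has_sup S by split; [exists (Num.min 1 e0) | exists 1].
pose t := sup S.
have t1 : t <= 1 by apply: ge_sup => //; exists (Num.min 1 e0).
have t0 : 0 < t.
  by have [/andP[s0 _] _] := S0; apply: (lt_le_trans s0); exact: sup_upper_bound.
have [|e e_gt0 [lam2 [c2 h2]]] := loc t; first by rewrite ltW.
have [s Ss st] := sup_adherent e_gt0 supS.
have [/andP[s0 s1] [lam1 [c1 h1]]] := Ss.
have st' : s <= t by exact: sup_upper_bound.
have [|||lam [c h]] := @extremal_merge 0 (Num.max 0 (t - e)) s (Num.min 1 (t + e))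
  lam1 c1 lam2 c2 x _ _ _ h1 h2.
- by rewrite le_max lexx.
- by rewrite gt_max s0.
- by rewrite le_min s1 (le_trans st')// lerDl ltW.
have : S (Num.min 1 (t + e)).
  split; last by exists lam, c.
  by rewrite lt_min ltr01 addr_gt0//= ge_min lexx.
move=> /(sup_upper_bound supS); rewrite -/t ge_min => /orP[t1'|]; last first.
  by rewrite leNgt ltrDl e_gt0.
by exists lam, c; move: h; rewrite min_l// (le_trans t1')// lerDl ltW.
Qed.

End Extremals.

(** * Short extremal arcs minimize the energy *)

Section LocalMinimality.
Context {R : realType} {n : nat} {G : contactCarnot R n}.
Local Notation m := (2 * n)%N.
Local Notation A := (cc_A G).

Lemma dotp_CauchySchwarz (k : nat) (x y : 'rV[R]_k) :
  dotp x y ^+ 2 <= dotp x x * dotp y y.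
Proof.
have [->|y0] := eqVneq y 0; first by rewrite !dotp0r expr0n mulr0.
have yy : 0 < dotp y y by rewrite dotp_gt0.
have := dotp_ge0 (dotp y y *: x - dotp x y *: y).
rewrite dotpBl !dotpBr !dotpZl !dotpZr (dotpC y x).
rewrite [X in 0 <= X](_ : _ = dotp y y * (dotp x x * dotp y y - dotp x y ^+ 2)); last by ring.
by rewrite pmulr_rge0// subr_ge0.
Qed.

Lemma mulmx_bounded (k : nat) (B : 'M[R]_k) :
  exists2 K, 0 <= K & forall x : 'rV[R]_k, dotp (x *m B) (x *m B) <= K * dotp x x.
Proof.
exists (\sum_i dotp (col i B)^T (col i B)^T).
  by apply: sumr_ge0 => i _; exact: dotp_ge0.
move=> x; rewrite {1}/dotp mulr_suml; apply: ler_sum => i _; rewrite -expr2 mulrC.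
have -> : (x *m B) 0 i = dotp x (col i B)^T.
  by rewrite mxE; apply: eq_bigr => j _; rewrite !mxE.
exact: dotp_CauchySchwarz.
Qed.

(* The excess energy of a competitor is at least the derivative of a function that
   vanishes at both ends; the term [phi |d|^2] with [phi' >= phi^2 + lam^2 K / 4] is
   the Riccati correction. *)
Lemma extremal_minimizing (lam : R) (c : 'rV[R]_m) (x : R -> 'rV[R]_m) (z : R -> R) (K a b : R) :
  (forall (t : R) i, is_derive t 1 (fun s => x s 0 i) (momentum (G := G) lam c x t 0 i)) ->
  (forall v : 'rV[R]_m, dotp (v *m A) (v *m A) <= K * dotp v v) -> 0 <= K ->
  a < b -> lam ^+ 2 * K * (b - a) ^+ 2 <= 1 ->
  hcurve (G := G) a b x z (momentum (G := G) lam c x) ->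
  coord_minimizing (G := G) a b x z (momentum (G := G) lam c x).
Proof.
move=> dx AK K0 ab small hcx y w v hcy ya yb wa wb.
have [hx hz] := hcx; have [hy hw] := hcy.
pose u := momentum (G := G) lam c x.
pose d t := y t - x t; pose d' t := v t - u t.
have hd i : lipschitz_derivative a b (fun t => d t 0 i) (fun t => d' t 0 i).
  have := lipschitz_derivativeB (hy i) (hx i).
  rewrite (_ : (fun t => y t 0 i - x t 0 i) = fun t => d t 0 i); last first.
    by apply/funext => t; rewrite /d [RHS]mxE [X in _ = _ + X]mxE.
  rewrite (_ : (fun t => v t 0 i - _) = fun t => d' t 0 i)//.
  by apply/funext => t; rewrite /d' [RHS]mxE [X in _ = _ + X]mxE.
have hxA := lipschitz_derivative_mulmx A hx.
(* This slope is twice [lam^2 K / 4]. The smallness of [b - a] bounds [phi^2] by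
   [be / 2 = lam^2 K / 4], which is the other half. *)
pose be := 2^-1 * (lam ^+ 2 * K).
pose phi t := be * (t - a).
have hphi : lipschitz_derivative a b phi (fun=> be).
  have := lipschitz_derivativeZ be (lipschitz_derivativeB (lipschitz_derivative_id a b)
    (lipschitz_derivative_cst a b a)).
  by under [X in lipschitz_derivative _ _ _ X]eq_fun do rewrite subr0 mulr1.
have hcst i : lipschitz_derivative a b (fun=> c 0 i) (fun=> (0 : 'rV[R]_m) 0 i).
  by rewrite mxE; exact: lipschitz_derivative_cst.
(* The function [2 c.d + 2 lam (w - z) + lam (x A).d - phi |d|^2] vanishes at both ends: its first
   three terms account for all of the excess that is linear in [d'] or [u]. *)
have H1 := lipschitz_derivativeZ 2 (lipschitz_derivative_dotp hcst hd).
have H2 := lipschitz_derivativeZ (2 * lam) (lipschitz_derivativeB hw hz).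
have H3 := lipschitz_derivativeZ lam (lipschitz_derivative_dotp hxA hd).
have H4 := lipschitz_derivativeM hphi (lipschitz_derivative_dotp hd hd).
have H := lipschitz_derivativeB (lipschitz_derivativeD (lipschitz_derivativeD H1 H2) H3) H4.
have I0 := lipschitz_FTC ab H.
have da : d a = 0 by rewrite /d ya subrr.
have db : d b = 0 by rewrite /d yb subrr.
move: I0; rewrite da db wa wb !dotp0r !subrr !mulr0 !addr0 !subrr => I0.
have [_ bg] := lipschitz_derivative_bounded H.
have bv i : bounded_measurable a b (fun t => v t 0 i).
  by case: (lipschitz_derivative_bounded (hy i)).
have bu i : bounded_measurable a b (fun t => u t 0 i).
  by case: (lipschitz_derivative_bounded (hx i)).
suff : integral_cc a b (fun t => dotp (u t) (u t)) + 0 <=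
    integral_cc a b (fun t => dotp (v t) (v t)) by rewrite addr0.
rewrite -{1}I0 -integral_ccD//; last by bounded_measurable_tac.
apply: le_integral_cc; [|by bounded_measurable_tac|].
  by apply: bounded_measurableD => //; bounded_measurable_tac.
apply: aeW => t /andP[at_ tb].
have vE : v t = u t + d' t by rewrite /d' addrC subrK.
have yE : y t = x t + d t by rewrite /d addrC subrK.
rewrite vE yE -/u dotp0l add0r.
have uE : u t = c + lam *: (x t *m A) by [].
(* The excess minus the derivative above is this square plus [be |d|^2 - phi^2 |d|^2 - lam^2 |d A|^2
   / 4]; the cross term of [d A] with [d] vanishes by skewness. *)
have p0 := dotp_ge0 (d' t - (2^-1 * lam) *: (d t *m A) + phi t *: d t).
have dAd := area_diag (G := G) (d t).
have AKd := AK (d t).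
have dd0 := dotp_ge0 (d t).
have skew1 : dotp (u t *m A) (d t) = - dotp (d t *m A) (u t) by exact: area_skew.
have c1 : dotp (u t) (d' t) = dotp c (d' t) + lam * dotp (x t *m A) (d' t).
  by rewrite {1}uE dotpDl dotpZl.
have phi2 : phi t ^+ 2 <= be / 2.
  have h : (t - a) ^+ 2 <= (b - a) ^+ 2.
    by rewrite ler_sqr ?nnegrE ?subr_ge0 ?(ltW ab)// lerB.
  rewrite /phi exprMn; have be0 : 0 <= be by rewrite mulr_ge0 ?invr_ge0 ?ler0n// mulr_ge0 ?sqr_ge0.
  have : be ^+ 2 * (t - a) ^+ 2 <= be ^+ 2 * (b - a) ^+ 2 by rewrite ler_wpM2l ?sqr_ge0.
  move=> /le_trans; apply.
  have : be * (be * (b - a) ^+ 2) <= be * (1 / 2).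
    rewrite ler_wpM2l//; rewrite /be; lra.
  rewrite expr2; lra.
clear uE vE yE; move: p0 dAd AKd dd0 skew1 c1 phi2.
move: (d t) (d' t) (u t) (x t *m A) (phi t) (mulmxDl (x t) (d t) A).
move=> D D' U XA P -> p0 dAd AKd dd0 skew1 c1 phi2.
move: p0; rewrite !(dotpDl, dotpDr, dotpNl, dotpNr, dotpZl, dotpZr).
rewrite (dotpC D (D *m A)) dAd (dotpC D' (D *m A)) (dotpC D' D) (dotpC D' U) skew1 c1.
set X1 := dotp D' D'; set X2 := dotp (D *m A) D'.
set X3 := dotp (D *m A) (D *m A); set X4 := dotp D D'.
set X5 := dotp D D; set X6 := dotp XA D'.
set X7 := dotp (D *m A) U.
move=> p0.
have q1 : lam ^+ 2 * X3 <= lam ^+ 2 * (K * X5) by rewrite ler_wpM2l ?sqr_ge0.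
have q2 : P ^+ 2 * X5 <= be / 2 * X5 by rewrite ler_wpM2r.
have q3 : be * X5 = 2^-1 * (lam ^+ 2 * (K * X5)) by rewrite /be; ring.
lra.
Qed.

End LocalMinimality.

(** * Spectral decomposition *)

Section Spectral.
Context {R : realType} {m : nat}.
Implicit Types (B W : 'M[R]_m) (v w : 'rV[R]_m).

Lemma continuous_row_entry i : continuous (fun v => v 0 i).
Proof. by move=> v; exact: coord_continuous. Qed.

Lemma continuous_bigsum (I : finType) (T : topologicalType) (f : I -> T -> R) :
  (forall i, continuous (f i)) -> continuous (fun t => \sum_i f i t).
Proof.
move=> H; elim: (index_enum I) => [|i r IH] t.
  by under eq_fun do rewrite big_nil; exact: cvg_cst.
by under eq_fun do rewrite big_cons; apply: cvgD; [exact: H | exact: IH].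
Qed.

Lemma continuous_mulmx_entry W i : continuous (fun v => (v *m W) 0 i).
Proof.
rewrite (_ : (fun v => (v *m W) 0 i) = (fun v => \sum_j v 0 j * W j i)); last first.
  by apply/funext => v; rewrite mxE.
apply: continuous_bigsum => j w.
exact: cvgM (@continuous_row_entry j w) (cvg_cst (W j i)).
Qed.

Lemma continuous_dotp_mulmx B : continuous (fun v => dotp (v *m B) v).
Proof.
apply: continuous_bigsum => i v.
exact: cvgM (@continuous_mulmx_entry B i v) (@continuous_row_entry i v).
Qed.

Lemma compact_sphere W :
  compact [set v | dotp v v = 1 /\ v *m W = 0].
Proof.
apply: bounded_closed_compact.
  exists 1; split; first exact: num_real.
  move=> M M1 v /= [v1 _]; rewrite /Num.norm/= mx_normrE.
  apply: bigmax_le; first exact: ltW (lt_trans ltr01 M1).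
  move=> [i j] _ /=; rewrite (le_trans _ (ltW M1))// (ord1 i).
  rewrite -[leRHS]normr1 -ler_sqr ?nnegrE// !real_normK ?num_real// expr1n -v1.
  rewrite /dotp (bigD1 j)//= -expr2 lerDl; apply: sumr_ge0 => k _.
  by rewrite -expr2 sqr_ge0.
rewrite (_ : [set v | _] = (fun v => dotp v v) @^-1` [set 1] `&`
  \bigcap_(i in setT) ((fun v => (v *m W) 0 i) @^-1` [set 0])); last first.
  apply/seteqP; split => v /= [v1 v2]; split=> //.
    by move=> i _ /=; rewrite v2 mxE.
  by apply/rowP => i; rewrite [RHS]mxE; exact: (v2 i I).
apply: closedI.
  apply: preimage_closed; last exact: closed_eq.
  rewrite (_ : (fun v => dotp v v) = (fun v => dotp (v *m 1%:M) v)); last first.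
    by apply/funext => v; rewrite mulmx1.
  by move=> v _; exact: continuous_dotp_mulmx.
apply: closed_bigI => i _; apply: preimage_closed; last exact: closed_eq.
by move=> v _; exact: continuous_mulmx_entry.
Qed.

(* The maximizer of the Rayleigh quotient on the invariant subspace [v *m W = 0]. *)
Lemma symmetric_eigenvector B W : B^T = B ->
  (forall v, v *m W = 0 -> v *m B *m W = 0) ->
  (exists2 v : 'rV[R]_m, v != 0 & v *m W = 0) ->
  exists2 v : 'rV[R]_m, v != 0 & v *m W = 0 /\ v *m B = dotp (v *m B) v / dotp v v *: v.
Proof.
move=> Bsym inv [v1 v10 v1W].
pose C : set 'rV[R]_m := [set v | dotp v v = 1 /\ v *m W = 0].
have normalize v : v != 0 -> v *m W = 0 -> C ((Num.sqrt (dotp v v))^-1 *: v).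
  move=> v0 vW; split; last by rewrite -scalemxAl vW scaler0.
  have vv : 0 < dotp v v by rewrite dotp_gt0.
  rewrite dotpZl dotpZr mulrA -expr2 exprVn sqr_sqrtr ?(ltW vv)//.
  by rewrite mulVf// gt_eqF.
have C0 : C !=set0 by exists ((Num.sqrt (dotp v1 v1))^-1 *: v1); exact: normalize.
have [v /set_mem[vv vW] vmax] := compact_EVT_max C0 (@compact_sphere W)
  (continuous_subspaceT (@continuous_dotp_mulmx B)).
have v0 : v != 0 by rewrite -dotp_eq0 vv oner_eq0.
pose M := dotp (v *m B) v.
have quad w : w *m W = 0 -> dotp (w *m B) w <= M * dotp w w.
  move=> wW; have [->|w0] := eqVneq w 0; first by rewrite !dotp0r mulr0.
  have ww : 0 < dotp w w by rewrite dotp_gt0.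
  have := vmax _ (mem_set (normalize w w0 wW)).
  rewrite -scalemxAl dotpZl dotpZr mulrA -expr2 exprVn sqr_sqrtr ?(ltW ww)//.
  by rewrite mulrC ler_pdivrMr.
(* The first variation of the Rayleigh quotient at its maximizer vanishes in every direction of the
   subspace. *)
have lin w : w *m W = 0 -> dotp (v *m B) w - M * dotp v w = 0.
  move=> wW; pose F := dotp (w *m B) w - M * dotp w w.
  suff : - 2 * (dotp (v *m B) w - M * dotp v w) = 0.
    by move=> /eqP; rewrite mulf_eq0 oppr_eq0 pnatr_eq0/= => /eqP.
  apply: (@linear_coefficient_eq0 _ _ (- F) 0 0 1 ltr01) => s _.
  have := quad (v + s *: w); rewrite mulmxDl vW -scalemxAl wW scaler0 addr0.
  move=> /(_ erefl).
  have E : dotp (w *m B) v = dotp (v *m B) w by rewrite dotp_mulmx Bsym dotpC.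
  rewrite mulmxDl -scalemxAl !(dotpDl, dotpDr, dotpZl, dotpZr) E vv -/M (dotpC w v) /F.
  lra.
exists v => //; split => //; rewrite vv divr1 -/M.
apply/eqP; rewrite -subr_eq0 -dotp_eq0; apply/eqP.
(* This defect lies in the invariant subspace, so it may be used as a test direction against
   itself. *)
set w := (v *m B - M *: v).
have wW : w *m W = 0 by rewrite mulmxBl inv// -scalemxAl vW scaler0 subrr.
by rewrite {1}/w dotpBl dotpZl lin.
Qed.

(** If the eigenspaces did not span, their orthogonal complement, which is invariant, would contain
    an eigenvector. Its eigenvalue is nonnegative, hence a squared singular value, so the
    eigenvector would lie in one of the eigenspaces and be orthogonal to itself. *)
Lemma spectral_decomposition (I : finType) (al : I -> R) (A : 'M[R]_m) :
  (forall s : R, singular_value A s -> exists i, s = al i) ->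
  forall v, exists vs : I -> 'rV[R]_m, v = \sum_i vs i /\
    forall i, vs i *m (A^T *m A) = al i ^+ 2 *: vs i.
Proof.
move=> sv v.
pose B := A^T *m A; pose E i := eigenspace B (al i ^+ 2).
pose W := (\sum_i E i)%MS.
have Bsym : B^T = B by rewrite /B trmx_mul trmxK.
have stab : stablemx W B.
  apply: stablemx_sums => i; rewrite /=.
  by have /eigenspaceP -> := submx_refl (E i); exact: scalemx_sub.
have full : row_full W.
  apply: contraT => notfull.
  have [||w w0 [wW wB]] := @symmetric_eigenvector B W^T Bsym.
  - move=> w wW; case/submxP: stab => D DE.
    rewrite -mulmxA -{1}Bsym -trmx_mul DE trmx_mul mulmxA wW mul0mx//.
  - have : kermx W^T != 0.
      rewrite kermx_eq0 row_free_unit.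
      apply: contra notfull => /mxrank_unit; rewrite mxrank_tr => rW.
      by rewrite /row_full rW.
    move=> /rowV0Pn[w /sub_kermxP wW w0]; by exists w.
  pose M := dotp (w *m B) w / dotp w w.
  have M0 : 0 <= M.
    rewrite divr_ge0 ?dotp_ge0// /B mulmxA dotp_mulmx dotp_ge0//.
  have : singular_value A (Num.sqrt M).
    split; first exact: sqrtr_ge0.
    rewrite sqr_sqrtr//; apply/eigenvalueP; exists w => //.
  case/sv => i Mi.
  have wE : (w <= E i)%MS by apply/eigenspaceP; rewrite -Mi sqr_sqrtr.
  have /submxP[D wD] : (w <= W)%MS by apply: submx_trans wE _; rewrite (sumsmx_sup i).
  move: w0; rewrite -dotp_eq0 dotpE {2}wD trmx_mul mulmxA wW mul0mx mxE eqxx//.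
have /sub_sumsmxP[u vE] : (v <= W)%MS by exact: submx_full.
exists (fun i => u i *m E i); split => // i.
by apply/eigenspaceP; exact: submxMl.
Qed.

Lemma eigenvector_orthogonal B v w (a b : R) : B^T = B -> a != b ->
  v *m B = a *: v -> w *m B = b *: w -> dotp v w = 0.
Proof.
move=> Bs ab va wb; apply/eqP.
have : a * dotp v w = b * dotp v w by rewrite -dotpZl -va dotp_mulmx Bs wb dotpZr.
move=> /eqP; rewrite -subr_eq0 -mulrBl mulf_eq0 subr_eq0 (negbTE ab); exact.
Qed.

End Spectral.

(** * Trigonometric inequalities *)

Section Trigonometry.
Context {R : realType}.
Implicit Types (a b t th h : R) (f : R -> R).

Lemma derivative_ge0_le a b f (f' : R -> R) : a <= b ->
  (forall t, is_derive t 1 f (f' t)) -> (forall t, a < t < b -> 0 <= f' t) ->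
  f a <= f b.
Proof.
rewrite le_eqVlt => /predU1P[->//|ab] df f0.
have cf : {within `[a, b], continuous f}.
  by apply: derivable_within_continuous => t _; case: (df t).
have [t] := MVT ab (fun t _ => df t) cf.
rewrite in_itv/= => /f0 ft E; rewrite -subr_ge0 E mulr_ge0// subr_ge0 ltW//.
Qed.

Lemma derivative_gt0_lt a b f (f' : R -> R) : a < b ->
  (forall t, a <= t <= b -> is_derive t 1 f (f' t)) ->
  (forall t, a < t < b -> 0 < f' t) -> f a < f b.
Proof.
move=> ab df f0.
have cf : {within `[a, b], continuous f}.
  by apply: derivable_within_continuous => t; rewrite in_itv/= => /df[].
have df' t : t \in `]a, b[ -> is_derive t 1 f (f' t).
  by rewrite in_itv/= => /andP[at_ tb]; apply: df; rewrite !ltW.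
have [t] := MVT ab df' cf.
rewrite in_itv/= => /f0 ft E; rewrite -subr_gt0 E mulr_gt0// subr_gt0//.
Qed.

Lemma one_minus_cos th : 1 - cos th = 2 * sin (th / 2) ^+ 2.
Proof.
have {1}-> : th = th / 2 + th / 2 by field.
rewrite cosD -!expr2; have := cos2Dsin2 (th / 2); lra.
Qed.

Lemma sin_double th : sin th = 2 * sin (th / 2) * cos (th / 2).
Proof.
have {1}-> : th = th / 2 + th / 2 by field.
rewrite sinD; ring.
Qed.

Lemma mul_cos_lt_sin h : 0 < h <= pi -> h * cos h < sin h.
Proof.
move=> /andP[h0 hpi]; rewrite -subr_gt0.
have d t : is_derive t 1 (fun t => sin t + - (t * cos t)) (t * sin t).
  have := is_derive_add (is_derive_sin t) (is_derive_opp
    (is_derive_mul (is_derive_id t 1) (is_derive_cos t))).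
  by rewrite (_ : cos t + _ = t * sin t)//; ring.
have := @derivative_gt0_lt 0 h (fun t => sin t + - (t * cos t)) (fun t => t * sin t) h0
  (fun t _ => d t).
rewrite sin0 mul0r subr0; apply => t /andP[t0 th].
by rewrite mulr_gt0// sin_gt0_pi// t0 (lt_le_trans th hpi).
Qed.

(** The difference of the two sides vanishes at [0] and at [pi], and its derivative
    [(pi / 2 - t) sin t] changes sign once, from plus to minus. *)
Lemma sub_sin_ge_tangent th : 0 <= th <= pi ->
  (1 - cos th) * (th - pi / 2) <= th - sin th.
Proof.
move=> /andP[th0 thpi].
pose f t : R := (t * cos t + - sin t) + pi / 2 * (1 + - cos t).
have d t : is_derive t 1 f ((pi / 2 - t) * sin t).
  have := is_derive_add (is_derive_add
    (is_derive_mul (is_derive_id t 1) (is_derive_cos t)) (is_derive_opp (is_derive_sin t)))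
    (is_derive_scale (pi / 2) (is_derive_add (is_derive_cst (1 : R) t 1)
      (is_derive_opp (is_derive_cos t)))).
  by rewrite (_ : _ + pi / 2 * _ = (pi / 2 - t) * sin t)//; ring.
suff : 0 <= f th by rewrite /f; lra.
have [h|h] := leP th (pi / 2).
  have := @derivative_ge0_le 0 th f _ th0 d.
  have -> : f 0 = 0 by rewrite /f sin0 cos0; ring.
  apply => t /andP[t0 tth]; rewrite mulr_ge0//; first by lra.
  by rewrite sin_ge0_pi// ltW//= (le_trans (ltW tth) thpi).
have := @derivative_ge0_le th pi (fun t => - f t) _ thpi (fun t => is_derive_opp (d t)).
have -> : - f pi = 0 by rewrite /f sinpi cospi; lra.
rewrite lerNl oppr0; apply => t /andP[tth tpi].
rewrite -mulNr mulr_ge0//; first by lra.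
by rewrite sin_ge0_pi// (le_trans th0 (ltW tth)) ltW.
Qed.

(** As [t - sin t] is nondecreasing, the right side is at least [pi]; the left side is at most [pi]
    because [1 - cos th <= 2]. *)
Lemma sub_sin_ge_pi th : pi <= th -> (1 - cos th) * (pi / 2) <= th - sin th.
Proof.
move=> thpi.
have d t : is_derive t 1 (fun t => t + - sin t) (1 + - cos t).
  exact: is_derive_add (is_derive_id t 1) (is_derive_opp (is_derive_sin t)).
have := @derivative_ge0_le pi th _ _ thpi d; rewrite sinpi subr0 => H.
have : pi <= th - sin th by apply: H => t _; rewrite subr_ge0 cos_le1.
apply: le_trans; have := cos_geN1 th; have := pi_gt0 R; nra.
Qed.

(** At [0] the convention for division by zero gives the value [0], which is also the limit
    there. *)
Definition arc_ratio th : R := (th - sin th) / (4 * (1 - cos th)).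

Lemma arc_ratioN th : arc_ratio (- th) = - arc_ratio th.
Proof. by rewrite /arc_ratio sinN cosN -opprD mulNr. Qed.

Lemma arc_ratio0 : arc_ratio 0 = 0.
Proof. by rewrite /arc_ratio sin0 subrr mul0r. Qed.

Lemma one_minus_cos_gt0 th : 0 < th <= pi -> 0 < 1 - cos th.
Proof.
move=> /andP[th0 thpi]; rewrite one_minus_cos mulr_gt0// exprn_gt0// sin_gt0_pi//.
by have := pi_gt0 R => p0; apply/andP; split; lra.
Qed.

Lemma is_derive_arc_ratio th : 0 < th <= pi ->
  is_derive th 1 arc_ratio
    (((1 - cos th) ^+ 2 - (th - sin th) * sin th) / (4 * (1 - cos th) ^+ 2)).
Proof.
move=> thpi; have c0 := one_minus_cos_gt0 thpi.
have d1 : is_derive th 1 (fun t => t + - sin t) (1 + - cos th).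
  exact: is_derive_add (is_derive_id th 1) (is_derive_opp (is_derive_sin th)).
have d2 : is_derive th 1 (fun t => 4 * (1 + - cos t)) (4 * (0 + - - sin th)).
  by apply: is_derive_scale; apply: is_derive_add.
have n0 : 4 * (1 + - cos th) != 0 by rewrite mulf_neq0// ?pnatr_eq0// gt_eqF.
have d3 : is_derive th 1 (fun t => (4 * (1 + - cos t))^-1)
    (- (4 * (1 + - cos th)) ^- 2 *: (4 * (0 + - - sin th))) by exact: is_deriveV.
have := is_derive_mul d1 d3.
rewrite [X in is_derive _ _ _ X -> _](_ : _ = ((1 - cos th) ^+ 2 - (th - sin th) * sin th) /
  (4 * (1 - cos th) ^+ 2))//.
rewrite /GRing.scale/= add0r opprK; field.
by rewrite gt_eqF.
Qed.

Lemma arc_ratio_lt_pos a b : 0 < a -> a < b -> b <= pi -> arc_ratio a < arc_ratio b.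
Proof.
move=> a0 ab bpi.
have pos t : a <= t <= b -> 0 < t <= pi.
  by move=> /andP[at_ tb]; rewrite (lt_le_trans a0 at_) (le_trans tb bpi).
apply: (derivative_gt0_lt ab (fun t tab => is_derive_arc_ratio (pos t tab))) => t /andP[at_ tb].
have tpi : 0 < t < pi by rewrite (lt_trans a0 at_) (lt_le_trans tb bpi).
have tpi' : 0 < t <= pi by case/andP: tpi => -> /ltW ->.
rewrite divr_gt0//; last by rewrite mulr_gt0// exprn_gt0// one_minus_cos_gt0.
have cs := cos2Dsin2 t.
have -> : (1 - cos t) ^+ 2 - (t - sin t) * sin t = 2 * (1 - cos t) - t * sin t.
  have E : (1 - cos t) ^+ 2 - (t - sin t) * sin t =
      2 * (1 - cos t) - t * sin t + (cos t ^+ 2 + sin t ^+ 2 - 1) by ring.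
  by rewrite E cs subrr addr0.
(* In half angles the numerator of the derivative factors, and its sign is that of [sin h - h cos h]
   at [h = t / 2]. *)
have -> : 2 * (1 - cos t) - t * sin t =
    4 * (sin (t / 2) * (sin (t / 2) - t / 2 * cos (t / 2))).
  by rewrite one_minus_cos (sin_double t); field.
have h0 : 0 < t / 2 < pi by case/andP: tpi => *; apply/andP; split; lra.
rewrite mulr_gt0// mulr_gt0 ?sin_gt0_pi// subr_gt0 mul_cos_lt_sin//.
by case/andP: h0 => -> /ltW ->.
Qed.

Lemma sub_sin_gt0 th : 0 < th <= pi -> 0 < th - sin th.
Proof.
move=> /andP[th0 thpi].
have d t : is_derive t 1 (fun t => t + - sin t) (1 + - cos t).
  exact: is_derive_add (is_derive_id t 1) (is_derive_opp (is_derive_sin t)).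
have := @derivative_gt0_lt 0 th _ _ th0 (fun t _ => d t); rewrite sin0 subr0.
by apply => t /andP[t0 tth]; rewrite one_minus_cos_gt0// t0 (le_trans (ltW tth) thpi).
Qed.

Lemma arc_ratio_gt0 th : 0 < th <= pi -> 0 < arc_ratio th.
Proof.
by move=> h; rewrite divr_gt0 ?sub_sin_gt0// mulr_gt0// one_minus_cos_gt0.
Qed.

(** Equivalent to [th cos th <= sin th]. It replaces a study of continuity at [0], where the formula
    degenerates. *)
Lemma arc_ratio_le th : 0 < th <= pi -> arc_ratio th <= th / 4.
Proof.
move=> h; have c0 := one_minus_cos_gt0 h.
rewrite ler_pdivrMr ?mulr_gt0//; have := mul_cos_lt_sin h; lra.
Qed.

Lemma arc_ratio_lt a b : - pi <= a -> a < b -> b <= pi -> arc_ratio a < arc_ratio b.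
Proof.
move=> api ab bpi; have [a0|a0|a0] := ltgtP 0 a.
- exact: arc_ratio_lt_pos.
- have [b0|b0|b0] := ltgtP 0 b.
  + apply: (@lt_trans _ _ 0); last by rewrite arc_ratio_gt0// b0.
    by rewrite -oppr_gt0 -arc_ratioN arc_ratio_gt0// oppr_gt0 a0 lerNl.
  + rewrite -ltrN2 -!arc_ratioN arc_ratio_lt_pos// ?oppr_gt0 ?ltrN2//.
    by rewrite lerNl.
  + rewrite -b0 arc_ratio0 -oppr_gt0 -arc_ratioN arc_ratio_gt0// oppr_gt0 a0.
    by rewrite lerNl.
- by rewrite -a0 arc_ratio0 arc_ratio_gt0// a0 ab.
Qed.

End Trigonometry.

(** * Explicit extremals *)

Section Flow.
Context {R : realType} {n : nat} {G : contactCarnot R n} {J : finType}.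
Local Notation m := (2 * n)%N.
Local Notation A := (cc_A G).
Variables (al : J -> R).
Hypothesis al_gt0 : forall j, 0 < al j.
Hypothesis al_inj : injective al.
Implicit Types (vs : J -> 'rV[R]_m) (lam t : R).

Definition eigen_family vs := forall j, vs j *m (A^T *m A) = al j ^+ 2 *: vs j.

Lemma eigen_familyAA vs j : eigen_family vs -> vs j *m A *m A = - (al j ^+ 2 *: vs j).
Proof. by move=> /(_ j) <-; rewrite cc_A_skew mulNmx mulmxN opprK mulmxA. Qed.

Lemma eigen_orthogonal vs ws i j : eigen_family vs -> eigen_family ws -> i != j ->
  dotp (vs i) (ws j) = 0.
Proof.
move=> hv hw ij; apply: eigenvector_orthogonal (hv i) (hw j).
  by rewrite trmx_mul trmxK.
by rewrite eqrXn2 ?(ltW (al_gt0 _))// (inj_eq al_inj).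
Qed.

Lemma eigen_dotp_sum vs ws (f g : J -> R) : eigen_family vs -> eigen_family ws ->
  dotp (\sum_j f j *: vs j) (\sum_j g j *: ws j) = \sum_j f j * g j * dotp (vs j) (ws j).
Proof.
move=> hv hw; rewrite dotp_suml; apply: eq_bigr => i _; rewrite dotp_sumr.
rewrite (bigD1 i)//= big1 ?addr0 => [|j ji].
  by rewrite dotpZl dotpZr mulrA.
by rewrite dotpZl dotpZr eigen_orthogonal ?mulr0// eq_sym.
Qed.

Lemma eigen_sum_inj vs ws : eigen_family vs -> eigen_family ws ->
  \sum_j vs j = \sum_j ws j -> forall j, vs j = ws j.
Proof.
move=> hv hw E j; apply/eqP; rewrite -subr_eq0 -dotp_eq0.
pose d i := vs i - ws i.
have hd : eigen_family d by move=> i; rewrite mulmxBl hv hw scalerBr.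
have d0 : \sum_i d i = 0 by rewrite /d sumrB E subrr.
have : dotp (d j) (\sum_i d i) = 0 by rewrite d0 dotp0r.
rewrite dotp_sumr (bigD1 j)//= big1 ?addr0 => [->//|i ij].
by rewrite eigen_orthogonal// eq_sym.
Qed.

Lemma eigen_familyZ vs (f : J -> R) : eigen_family vs -> eigen_family (fun j => f j *: vs j).
Proof. by move=> hv j; rewrite -scalemxAl hv scalerA mulrC -scalerA. Qed.

(** The solution of [y' = lam y A] with [y(0)] the sum of the [vs j]: on the eigenspace of
    [alpha_j^2] the square of [A] is [- alpha_j^2], so the matrix exponential reduces to a cosine
    and a sine. *)
Definition flow vs lam t : 'rV[R]_m :=
  \sum_j (cos (lam * al j * t) *: vs j + (sin (lam * al j * t) / al j) *: (vs j *m A)).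

Lemma flowE vs lam t i : flow vs lam t 0 i =
  \sum_j (vs j 0 i * cos (lam * al j * t) + (vs j *m A) 0 i / al j * sin (lam * al j * t)).
Proof.
rewrite summxE; apply: eq_bigr => j _; rewrite mxE [X in X + _]mxE [X in _ + X]mxE; ring.
Qed.

Lemma is_derive_flow vs lam t i : eigen_family vs ->
  is_derive t 1 (fun s => flow vs lam s 0 i) ((lam *: (flow vs lam t *m A)) 0 i).
Proof.
move=> hv.
have dth j (s : R) : is_derive s 1 (fun r => lam * al j * r) (lam * al j).
  by have := is_derive_scale (lam * al j) (is_derive_id s 1); rewrite mulr1.
have dcos j : is_derive t 1 (fun s => cos (lam * al j * s)) (- sin (lam * al j * t) * (lam * al j)).
  exact: is_derive1_comp (is_derive_cos _) (dth j t).
have dsin j : is_derive t 1 (fun s => sin (lam * al j * s)) (cos (lam * al j * t) * (lam * al j)).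
  exact: is_derive1_comp (is_derive_sin _) (dth j t).
have := is_derive_bigsum (fun j => is_derive_add (is_derive_scale (vs j 0 i) (dcos j))
  (is_derive_scale ((vs j *m A) 0 i / al j) (dsin j))).
rewrite (_ : (fun s => \sum_j _) = (fun s => flow vs lam s 0 i)); last first.
  by apply/funext => s; rewrite flowE.
rewrite [X in is_derive _ _ _ X -> _](_ : _ = (lam *: (flow vs lam t *m A)) 0 i)//.
rewrite mxE /flow mulmx_suml summxE mulr_sumr; apply: eq_bigr => j _.
rewrite mulmxDl -!scalemxAl (eigen_familyAA j hv) [in RHS]mxE.
rewrite [X in _ = _ * (X + _)]mxE [X in _ = _ * (_ + X)]mxE [X in _ = _ * (_ + _ * X)]mxE.
rewrite [X in _ = _ * (_ + _ * - X)]mxE; field.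
by rewrite gt_eqF.
Qed.

Lemma flow_norm vs lam s t : eigen_family vs ->
  dotp (flow vs lam s) (flow vs lam s) = dotp (flow vs lam t) (flow vs lam t).
Proof.
move=> hv; apply: (@is_derive_0_is_cst _ (fun s => dotp (flow vs lam s) (flow vs lam s))) => r.
have d i := @is_derive_flow vs lam r i hv.
have := is_derive_dotp d d.
by rewrite (dotpC (flow _ _ _)) dotpZl area_diag mulr0 addr0.
Qed.

Lemma flow0 vs lam : flow vs lam 0 = \sum_j vs j.
Proof.
by apply: eq_bigr => j _; rewrite mulr0 cos0 sin0 mul0r scale0r scale1r addr0.
Qed.

(** The integral of [flow] over [[-1/2, 1/2]]: the sine terms are odd and drop out, and the cosine
    terms integrate to these coefficients. *)
Definition chord vs lam : 'rV[R]_m :=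
  \sum_j (2 * sin (lam * al j / 2) / (lam * al j)) *: vs j.

Lemma flow_diff vs lam : lam != 0 ->
  flow vs lam 2^-1 - flow vs lam (- 2^-1) = lam *: (chord vs lam *m A).
Proof.
move=> lam0; rewrite -sumrB /chord mulmx_suml scaler_sumr; apply: eq_bigr => j _.
rewrite mulrN cosN sinN mulNr scaleNr opprD opprK addrACA subrr add0r -scalerDl.
rewrite -scalemxAl scalerA; congr (_ *: _); field.
by rewrite lam0 gt_eqF.
Qed.

(** The left side is [2 lam] times the end height of the extremal whose initial velocity is
    [flow vs lam (- 2^-1)]. *)
Lemma flow_energy vs lam : eigen_family vs -> lam != 0 ->
  dotp (flow vs lam (- 2^-1)) (flow vs lam (- 2^-1)) -
    dotp (flow vs lam (- 2^-1)) (chord vs lam) =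
  \sum_j dotp (vs j) (vs j) * (1 - sin (lam * al j) / (lam * al j)).
Proof.
move=> hv lam0; rewrite (flow_norm lam _ 0 hv) flow0.
have -> : \sum_j vs j = \sum_j 1 *: vs j by apply: eq_bigr => j _; rewrite scale1r.
rewrite eigen_dotp_sum//.
pose p := \sum_j (sin (lam * al j / 2) / al j) *: vs j.
have chE : chord vs lam = (2 / lam) *: p.
  rewrite /chord scaler_sumr; apply: eq_bigr => j _; rewrite scalerA; congr (_ *: _).
  by field; rewrite lam0 gt_eqF.
(* The chord is parallel to [p], so [p A] is orthogonal to it and only the cosine part contributes
   to the product. *)
have flE : flow vs lam (- 2^-1) = \sum_j cos (lam * al j / 2) *: vs j - p *m A.
  rewrite /p mulmx_suml -sumrB; apply: eq_bigr => j _.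
  by rewrite mulrN cosN sinN mulNr scaleNr -scalemxAl.
rewrite flE dotpBl {2}chE dotpZr area_diag mulr0 subr0 /chord eigen_dotp_sum// -sumrB.
apply: eq_bigr => j _; rewrite (sin_double (lam * al j)); field.
by rewrite lam0 gt_eqF.
Qed.

End Flow.

(** * Geodesics are exactly the explicit extremals *)

Section ExtremalCurves.
Context {R : realType} {n : nat} {G : contactCarnot R n} {J : finType}.
Local Notation m := (2 * n)%N.
Local Notation A := (cc_A G).
Local Notation mu := (@lebesgue_measure R).
Variables (al : J -> R).
Hypothesis al_gt0 : forall j, 0 < al j.
Hypothesis al_inj : injective al.
Hypothesis al_sv : forall s : R, singular_value A s -> exists j, s = al j.
Implicit Types (vs : J -> 'rV[R]_m) (lam t : R).

Lemma lipschitz_derivative_C2 a b (f f' f'' : R -> R) : a < b ->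
  (forall t, is_derive t 1 f (f' t)) -> (forall t, is_derive t 1 f' (f'' t)) ->
  lipschitz_derivative a b f f'.
Proof.
move=> ab d1 d2; apply: lipschitz_derivative_C1 => //.
  by apply: derivable_within_continuous => t _; case: (d1 t).
by apply: derivable_within_continuous => t _; case: (d2 t).
Qed.

Lemma lipschitz_derivative_eq0 a b (f f' : R -> R) : lipschitz_derivative a b f f' ->
  {ae mu, forall t, a <= t <= b -> f' t = 0} ->
  forall t, a <= t <= b -> f t = f a.
Proof.
move=> H f0 t /andP[]; rewrite le_eqVlt => /predU1P[<-//|at_] tb.
have H' := lipschitz_derivativeS (lexx a) tb H.
have := lipschitz_FTC at_ H'; rewrite (@ae_eq_integral_cc _ a t f' (fun=> 0)).
- by rewrite integral_cc_cst ?(ltW at_)// mul0r => /esym/subr0_eq.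
- by case: H'.
- exact: bounded_measurable_cst.
- by apply: ae_imply f0 => s + /andP[as_ st]; apply; rewrite as_ (le_trans st tb).
Qed.

(** Solves [y = c + lam x A] for [x], where [y] is the flow shifted so that its time 0 falls at
    1/2. *)
Definition curve_x vs lam t : 'rV[R]_m :=
  lam^-1 *: ((flow (G := G) al vs lam (t - 2^-1) - flow (G := G) al vs lam (- 2^-1)) *m invmx A).

(** From [lam (x A).y = |y|^2 - c.y] and the constancy of [|y|^2], the area equation integrates to
    [2 lam z = |c|^2 t - c.x]. *)
Definition curve_z vs lam t : R :=
  let c := flow (G := G) al vs lam (- 2^-1) in
  (2 * lam)^-1 * (dotp c c * t - dotp c (curve_x vs lam t)).

Lemma is_derive_flow_shift vs lam t i : eigen_family (G := G) al vs ->
  is_derive t 1 (fun s => flow (G := G) al vs lam (s - 2^-1) 0 i)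
    ((lam *: (flow (G := G) al vs lam (t - 2^-1) *m A)) 0 i).
Proof.
move=> hv.
have d := @is_derive_flow _ _ _ _ al al_gt0 vs lam (t - 2^-1) i hv.
have := @is_derive1_comp _ _ (shift (- 2^-1 : R)) t _ _ d (is_derive_shift _ _ _).
by rewrite mulr1.
Qed.

Lemma geodesic_extremal (eta : R -> G) : geodesic eta ->
  exists u lam c, [/\ hcurve (G := G) 0 1 (fun t => xcoord (eta t)) (fun t => zcoord (eta t)) u
    & {ae mu, forall t, 0 <= t <= 1 -> u t = momentum (G := G) lam c (fun t => xcoord (eta t)) t}].
Proof.
move=> [hor _ loc]; have [u hc] := horizontal_hcurve ltr01 hor.
have [|lam [c ext]] := @extremal_global _ _ G (fun t => xcoord (eta t)).
  move=> t t01; have [e e0 me] := loc t t01; exists e => //.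
  set a := Num.max _ _ in me *; set b := Num.min _ _ in me *.
  have /andP[t0 t1] := t01.
  have ab : a < b.
    by rewrite lt_min !gt_max ltr01 /=; apply/andP; split; [lra | apply/andP; split; lra].
  have a0 : 0 <= a by rewrite le_max lexx.
  have b1 : b <= 1 by rewrite ge_min lexx.
  have hc' : hcurve (G := G) a b (fun t => xcoord (eta t)) (fun t => zcoord (eta t)) u.
    by case: hc => hx hz; split => [i|]; apply: lipschitz_derivativeS; eauto.
  exact: euler_lagrange ab hc' (energy_minimizing_coord hc' me).
exists u, lam, c; split => //.
have [hx _] := hc.
have dx : {ae mu, forall t, forall i, 0 <= t <= 1 ->
    is_derive t 1 (fun s => xcoord (eta s) 0 i) (u t 0 i)}.
  by apply: ae_forall => i; case: (hx i).
apply: ae_imply (ae_and dx (ae_and (ae_neq 0) (ae_neq 1))) => t [d [n0 n1]] /[dup] t01 /andP[t0 t1].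
apply/rowP => i; have [_ <-] := d i t01.
by have [|_ <-] := ext t _ i; first by rewrite lt_neqAle eq_sym n0 t0/= lt_neqAle n1.
Qed.

Lemma geodesic_data (eta : R -> G) X Z : geodesic eta ->
  eta 0 = ecoords 0 0 -> eta 1 = ecoords X Z ->
  exists lam vs, eigen_family (G := G) al vs /\
    if lam == 0 then Z = 0 /\ forall t, 0 <= t <= 1 -> eta t = ecoords (t *: X) 0
    else [/\ X = chord al vs lam,
      2 * lam * Z = \sum_j dotp (vs j) (vs j) * (1 - sin (lam * al j) / (lam * al j))
      & forall t, 0 <= t <= 1 -> eta t = ecoords (curve_x vs lam t) (curve_z vs lam t)].
Proof.
move=> geo e0 e1; have [u [lam [c [[hx hz] uy]]]] := geodesic_extremal geo.
pose x t := xcoord (eta t); pose z t := zcoord (eta t).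
pose y := momentum (G := G) lam c x.
have x0 : x 0 = 0 by rewrite /x e0 xcoordE.
have z0 : z 0 = 0 by rewrite /z e0 zcoordE.
have x1 : x 1 = X by rewrite /x e1 xcoordE.
have z1 : z 1 = Z by rewrite /z e1 zcoordE.
have t01 : 0 <= (0 : R) <= 1 := introT andP (conj (lexx 0) ler01).
have t11 : 0 <= (1 : R) <= 1 := introT andP (conj ler01 (lexx 1)).
have [vs [vsE hv]] := spectral_decomposition al_sv (y 2^-1).
exists lam, vs; split=> //.
have uy' : {ae mu, forall t, 0 <= t <= 1 -> u t = y t} by exact: uy.
have [lam0|lam0] := eqVneq lam 0.
  have yc t : y t = c by rewrite /y /momentum lam0 scale0r addr0.
  have xE t : 0 <= t <= 1 -> x t = t *: c.
    move=> tab; apply/rowP => i; rewrite [RHS]mxE mulrC.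
    have H := lipschitz_derivativeB (hx i)
      (lipschitz_derivativeZ (c 0 i) (lipschitz_derivative_id 0 1)).
    have x0i : xcoord (eta 0) 0 i = 0 by rewrite -/(x 0) x0 mxE.
    have := lipschitz_derivative_eq0 H _ tab; rewrite /= x0i mulr0 subr0 => E.
    apply: subr0_eq; apply: E.
    by apply: ae_imply uy' => s + s01 => /(_ s01) ->; rewrite yc mulr1 subrr.
  have Xc : X = c by rewrite -x1 xE// scale1r.
  have zE t : 0 <= t <= 1 -> z t = 0.
    move=> tab; rewrite /z (lipschitz_derivative_eq0 hz _ tab)//.
    apply: ae_imply uy' => s + s01 => /(_ s01) ->.
    by rewrite yc -/(x s) xE// -scalemxAl dotpZl area_diag !mulr0.
  split; first by rewrite -z1 zE.
  by move=> t tab; rewrite Xc -(xE t tab) -(zE t tab) ecoordsK.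
pose fl t := flow (G := G) al vs lam (t - 2^-1).
have dfl t i := @is_derive_flow_shift vs lam t i hv.
have ddfl t i : is_derive t 1 (fun s => (lam *: (fl s *m A)) 0 i)
    ((lam *: (lam *: (fl t *m A) *m A)) 0 i).
  have := is_derive_scale lam (is_derive_mulmx A (dfl t) i).
  rewrite [X in _ -> is_derive _ _ _ X]mxE.
  by rewrite (_ : (fun s => lam * _) = (fun s => (lam *: (fl s *m A)) 0 i))//;
    apply/funext => s; rewrite [RHS]mxE.
have hfl i := lipschitz_derivative_C2 ltr01 (fun t => dfl t i) (fun t => ddfl t i).
(* Uniqueness for the linear equation without a Gronwall estimate: the difference satisfies
   [D' = lam D A] almost everywhere, so its length is constant by skewness, and it vanishes at time
   1/2. *)
pose D t := y t - fl t.
pose D' t := lam *: (u t *m A) - lam *: (fl t *m A).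
have hD i : lipschitz_derivative 0 1 (fun t => D t 0 i) (fun t => D' t 0 i).
  have := lipschitz_derivativeB (lipschitz_derivativeD (lipschitz_derivative_cst 0 1 (c 0 i))
    (lipschitz_derivativeZ lam (lipschitz_derivative_mulmx A hx i))) (hfl i).
  rewrite (_ : (fun t => _ - _) = (fun t => D t 0 i)); last first.
    apply/funext => t; rewrite /D /y /momentum [RHS]mxE [X in _ = X + _]mxE [X in _ = _ + X]mxE.
    by congr (_ + _ - _); rewrite [RHS]mxE.
  rewrite (_ : (fun t => _ - _) = (fun t => D' t 0 i))//.
  apply/funext => t; rewrite /D' [RHS]mxE [X in _ = X + _]mxE [X in _ = _ + X]mxE add0r.
  by [].
have yfl t : 0 <= t <= 1 -> y t = fl t.
  move=> tab.
  have E : {ae mu, forall t, 0 <= t <= 1 -> dotp (D' t) (D t) + dotp (D t) (D' t) = 0}.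
    apply: ae_imply uy' => s + s01 => /(_ s01) us.
    rewrite (dotpC (D s)) /D' us -scalerBr -mulmxBl -/(D s) dotpZl area_diag mulr0 addr0//.
  have cD := lipschitz_derivative_eq0 (lipschitz_derivative_dotp hD hD) E.
  have h01 : 0 <= (2^-1 : R) <= 1 by apply/andP; split; lra.
  have Dh : D 2^-1 = 0 by rewrite /D /fl subrr flow0 -vsE subrr.
  apply/subr0_eq/eqP; rewrite -/(D t) -dotp_eq0 (cD t tab) -(cD _ h01) Dh dotp0l//.
have cE : c = flow (G := G) al vs lam (- 2^-1).
  by have := yfl 0 t01; rewrite /y /momentum x0 mul0mx scaler0 addr0 /fl sub0r.
have xAE t : 0 <= t <= 1 -> x t = curve_x vs lam t.
  move=> tab; rewrite /curve_x -/(fl t) -yfl// -cE /y /momentum addrAC subrr add0r.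
  by rewrite -scalemxAl scalerA mulVf// scale1r mulmxK// cc_A_unit.
have XE : X = chord al vs lam.
  rewrite -x1 xAE// /curve_x (_ : 1 - 2^-1 = 2^-1); last by lra.
  rewrite (flow_diff al_gt0)// -scalemxAl scalerA mulVf// scale1r mulmxK// cc_A_unit//.
have hcst i : lipschitz_derivative 0 1 (fun=> c 0 i) (fun=> (0 : 'rV[R]_m) 0 i).
  by rewrite mxE; exact: lipschitz_derivative_cst.
have zE t : 0 <= t <= 1 -> 2 * lam * z t = dotp c c * t - dotp c (x t).
  move=> tab.
  have H := lipschitz_derivativeB (lipschitz_derivativeZ (2 * lam) hz)
    (lipschitz_derivativeB (lipschitz_derivativeZ (dotp c c) (lipschitz_derivative_id 0 1))
      (lipschitz_derivative_dotp hcst hx)).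
  have := lipschitz_derivative_eq0 H _ tab.
  rewrite -/(z 0) -/(x 0) -/(z t) -/(x t) x0 z0 !mulr0 dotp0r !subrr => E.
  apply: subr0_eq; apply: E; apply: ae_imply uy' => s + s01 => /(_ s01) ->.
  have ny : dotp (y s) (y s) = dotp c c by rewrite yfl// cE; exact: flow_norm.
  have yx : lam * dotp (x s *m A) (y s) = dotp (y s) (y s) - dotp c (y s).
    by rewrite -dotpZl -dotpBl; congr dotp; rewrite /y /momentum addrC addKr.
  rewrite -/(x s) dotp0l add0r mulr1 -ny.
  have -> : 2 * lam * (2^-1 * dotp (x s *m A) (y s)) = lam * dotp (x s *m A) (y s) by field.
  by rewrite yx; ring.
split=> //.
  by rewrite -z1 zE// x1 mulr1 XE cE (flow_energy al_gt0 al_inj).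
move=> t tab; rewrite -[LHS]ecoordsK -/(x t) -/(z t); congr ecoords; first exact: xAE.
rewrite /curve_z -cE -xAE// -zE// mulrA mulVf ?mul1r//.
by rewrite mulf_neq0// pnatr_eq0.
Qed.

Lemma smooth_extremal_geodesic lam (c : 'rV[R]_m) (x : R -> 'rV[R]_m) (z : R -> R) :
  (forall (t : R) i, is_derive t 1 (fun s => x s 0 i) (momentum (G := G) lam c x t 0 i)) ->
  (forall t : R, is_derive t 1 z (2^-1 * dotp (x t *m A) (momentum (G := G) lam c x t))) ->
  x 1 != x 0 -> geodesic (fun t => ecoords (x t) (z t) : G).
Proof.
move=> dx dz x10.
pose gamma t : G := ecoords (x t) (z t).
have xE : (fun t => xcoord (gamma t)) = x by apply/funext => t; rewrite xcoordE.
have zE : (fun t => zcoord (gamma t)) = z by apply/funext => t; rewrite zcoordE.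
pose y := momentum (G := G) lam c x.
have dy t := momentum_derive (dx t).
have hc a b : a < b -> hcurve (G := G) a b x z y.
  move=> ab; split.
    by move=> i; exact: lipschitz_derivative_C2 ab (fun t => dx t i) (fun t => dy t i).
  apply: (lipschitz_derivative_C2 ab dz (fun t =>
    is_derive_scale 2^-1 (is_derive_dotp (is_derive_mulmx A (dx t)) (dy t)))).
have hg a b : a < b ->
    hcurve (G := G) a b (fun t => xcoord (gamma t)) (fun t => zcoord (gamma t)) y.
  by rewrite xE zE; exact: hc.
split.
- exact: hcurve_horizontal (hg 0 1 ltr01).
- exists 1; first by rewrite ler01 lexx.
  by move=> /(congr1 xcoord); rewrite !xcoordE => E; move: x10; rewrite E eqxx.
move=> t /andP[t0 t1]; have [K K0 AK] := mulmx_bounded A.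
pose q := lam ^+ 2 * K.
have q0 : 0 <= q by rewrite mulr_ge0 ?sqr_ge0.
(* The interval then has length at most [1 / (1 + q)], and [q / (1 + q)^2 <= 1] is the smallness
   that [extremal_minimizing] asks for. *)
pose e := (2 * (1 + q))^-1.
have e0 : 0 < e by rewrite invr_gt0 mulr_gt0// ltr_wpDr.
exists e; first exact: e0.
set a := Num.max _ _; set b := Num.min _ _.
have ab : a < b.
  by rewrite lt_min !gt_max ltr01 /=; apply/andP; split; [lra | apply/andP; split; lra].
apply: (coord_energy_minimizing ab (hg a b ab)); rewrite xE zE.
apply: (extremal_minimizing dx AK K0 ab _ (hc a b ab)).
have ba : b - a <= 2 * e.
  have : b <= t + e by rewrite ge_min lexx orbT.
  have : t - e <= a by rewrite le_max lexx orbT.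
  lra.
have : (b - a) ^+ 2 <= (2 * e) ^+ 2.
  by rewrite ler_sqr ?nnegrE ?subr_ge0 ?(ltW ab)// mulr_ge0// ltW.
move=> h; apply: (@le_trans _ _ (q * (2 * e) ^+ 2)); first by rewrite ler_wpM2l.
have -> : 2 * e = (1 + q)^-1 by rewrite /e invfM mulrA divff ?mul1r// pnatr_eq0.
rewrite exprVn ler_pdivrMr ?mul1r; last by rewrite exprn_gt0// ltr_wpDr.
nra.
Qed.

Lemma flow_geodesic vs lam : eigen_family (G := G) al vs -> lam != 0 ->
  chord al vs lam != 0 ->
  [/\ geodesic (fun t => ecoords (curve_x vs lam t) (curve_z vs lam t) : G),
    curve_x vs lam 0 = 0, curve_z vs lam 0 = 0, curve_x vs lam 1 = chord al vs lam &
    2 * lam * curve_z vs lam 1 =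
      \sum_j dotp (vs j) (vs j) * (1 - sin (lam * al j) / (lam * al j))].
Proof.
move=> hv lam0 ch0; pose c := flow (G := G) al vs lam (- 2^-1).
have x0 : curve_x vs lam 0 = 0 by rewrite /curve_x sub0r subrr mul0mx scaler0.
have x1 : curve_x vs lam 1 = chord al vs lam.
  rewrite /curve_x (_ : 1 - 2^-1 = 2^-1); last by lra.
  by rewrite (flow_diff al_gt0)// -scalemxAl scalerA mulVf// scale1r mulmxK// cc_A_unit.
have l20 : 2 * lam != 0 by rewrite mulf_neq0// pnatr_eq0.
have yE t : momentum (G := G) lam c (curve_x vs lam) t = flow (G := G) al vs lam (t - 2^-1).
  rewrite /momentum /curve_x -scalemxAl scalerA divff// scale1r mulmxKV ?cc_A_unit//.
  by rewrite addrC subrK.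
have dx (t : R) i : is_derive t 1 (fun s => curve_x vs lam s 0 i)
    (momentum (G := G) lam c (curve_x vs lam) t 0 i).
  rewrite yE.
  have d k : is_derive t 1 (fun s => (flow (G := G) al vs lam (s - 2^-1) - c) 0 k)
      ((lam *: (flow (G := G) al vs lam (t - 2^-1) *m A)) 0 k).
    have := is_derive_add (@is_derive_flow_shift vs lam t k hv) (is_derive_cst (- c 0 k) t 1).
    rewrite addr0 (_ : (fun s => _ + _) =
      (fun s => (flow (G := G) al vs lam (s - 2^-1) - c) 0 k))//.
    by apply/funext => s; rewrite [RHS]mxE [X in _ = _ + X]mxE.
  have := is_derive_scale lam^-1 (is_derive_mulmx (invmx A) d i).
  rewrite (_ : (fun s => lam^-1 * _) = (fun s => curve_x vs lam s 0 i)); last first.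
    by apply/funext => s; rewrite [RHS]mxE.
  by rewrite -scalemxAl mulmxK ?cc_A_unit// [X in lam^-1 * X]mxE mulKf.
have dz (t : R) : is_derive t 1 (curve_z vs lam)
    (2^-1 * dotp (curve_x vs lam t *m A) (momentum (G := G) lam c (curve_x vs lam) t)).
  have dc i : is_derive t 1 (fun s : R => c 0 i) ((0 : 'rV[R]_m) 0 i).
    by rewrite [X in is_derive _ _ _ X]mxE; exact: is_derive_cst.
  have := is_derive_scale (2 * lam)^-1 (is_derive_add
    (is_derive_scale (dotp c c) (is_derive_id t 1))
    (is_derive_opp (is_derive_dotp dc (dx t)))).
  rewrite [X in is_derive _ _ _ X -> _](_ : _ = 2^-1 *
    dotp (curve_x vs lam t *m A) (momentum (G := G) lam c (curve_x vs lam) t))//.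
  set y := momentum _ _ _ _.
  have ny : dotp y y = dotp c c by rewrite /y yE; exact: flow_norm.
  have yx : lam * dotp (curve_x vs lam t *m A) y = dotp y y - dotp c y.
    by rewrite -dotpZl -dotpBl; congr dotp; rewrite /y /momentum addrC addKr.
  rewrite dotp0l add0r mulr1 -ny -yx; field.
  by rewrite lam0.
split=> //.
- by apply: smooth_extremal_geodesic dx dz _; rewrite x0 x1.
- by rewrite /curve_z x0 dotp0r mulr0 subr0 mulr0.
rewrite /curve_z x1 mulr1 mulrA divff// mul1r.
exact: (flow_energy al_gt0 al_inj).
Qed.

End ExtremalCurves.

(** * The height of an extremal *)

Section AreaBounds.
Context {R : realType}.
Implicit Types (ak al lam : R).

Definition area_constant a1 ak : R := pi / 8 * (2 * a1 ^+ 2 / ak - ak).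

(** The comparison in a single eigenspace. It serves twice: summed for large multipliers it rules
    them out, and at [lam = pi / ak] it shows that every height below the bound is attained. *)
Lemma area_inequality (a1 : R) ak al lam : 0 < a1 -> a1 <= al -> al <= ak ->
  0 < lam -> pi <= lam * ak ->
  4 * area_constant a1 ak * (1 - cos (lam * al)) <= al * (lam * al - sin (lam * al)).
Proof.
move=> a10 a1al alak lam0 pilam.
have al0 : 0 < al := lt_le_trans a10 a1al.
have ak0 : 0 < ak := lt_le_trans al0 alak.
have pi0 := pi_gt0 R.
have c0 : 0 <= 1 - cos (lam * al) by rewrite subr_ge0 cos_le1.
have BE : 4 * area_constant a1 ak = pi * (a1 ^+ 2 / ak) - ak * (pi / 2).
  by rewrite /area_constant; field; rewrite gt_eqF.
have a2 : a1 ^+ 2 <= al ^+ 2 by rewrite ler_sqr ?nnegrE ?(ltW a10) ?(ltW al0).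
have th0 : 0 < lam * al by rewrite mulr_gt0.
have [thpi|/ltW thpi] := leP (lam * al) pi.
  have H : (1 - cos (lam * al)) * (lam * al - pi / 2) <= lam * al - sin (lam * al).
    by apply: sub_sin_ge_tangent; rewrite (ltW th0).
  apply: (@le_trans _ _ (al * ((1 - cos (lam * al)) * (lam * al - pi / 2)))); last first.
    by rewrite ler_wpM2l// ltW.
  rewrite [leRHS]mulrCA [leLHS]mulrC ler_wpM2l// BE mulrBr lerB//; last first.
    by rewrite ler_wpM2r// divr_ge0// ltW.
  (* The lower bound [pi <= lam ak] turns [pi a1^2 / ak] into [lam a1^2], at most [lam al^2]. *)
  apply: (@le_trans _ _ (lam * ak * (a1 ^+ 2 / ak))).
    by rewrite ler_wpM2r// divr_ge0 ?sqr_ge0// ltW.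
  have -> : lam * ak * (a1 ^+ 2 / ak) = lam * a1 ^+ 2 by field; rewrite gt_eqF.
  by rewrite [leRHS]mulrCA -expr2 ler_wpM2l// ltW.
have H := sub_sin_ge_pi thpi.
apply: (@le_trans _ _ (al * ((1 - cos (lam * al)) * (pi / 2)))); last first.
  by rewrite ler_wpM2l// ltW.
rewrite [leRHS]mulrCA [leLHS]mulrC ler_wpM2l// BE.
(* Beyond [pi] it suffices that [4 B <= al pi / 2] for the constant [B]; this follows from
   [a1^2 / ak <= a1 <= al <= ak]. *)
have h1 : a1 ^+ 2 / ak <= a1.
  by rewrite ler_pdivrMr// expr2 ler_wpM2l ?(ltW a10)// (le_trans a1al alak).
have h2 : pi * (a1 ^+ 2 / ak) <= pi * a1 by rewrite ler_wpM2l// ltW.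
have h3 : pi * a1 <= pi * al by rewrite ler_wpM2l// ltW.
have h4 : pi * al <= pi * ak by rewrite ler_wpM2l// ltW.
lra.
Qed.

(** For an extremal the sum on the left is [|x|^2] and the one on the right is [2 lam z], so a large
    multiplier forces [|z|] up to the bound. Both sums are even in [lam], which reduces the claim to
    [lam > 0]. *)
Lemma energy_chord_inequality (J : finType) (al P : J -> R) a1 ak lam :
  0 < a1 -> (forall j, a1 <= al j <= ak) -> (forall j, 0 <= P j) ->
  lam != 0 -> pi <= `|lam| * ak ->
  2 * `|lam| * area_constant a1 ak *
    (\sum_j (2 * sin (lam * al j / 2) / (lam * al j)) ^+ 2 * P j) <=
  \sum_j P j * (1 - sin (lam * al j) / (lam * al j)).
Proof.
move=> a10 alb P0.
wlog lam0 : lam / 0 < lam.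
  move=> H l0 pil; case: (ltgtP lam 0) => [ln|lp|l00]; last by rewrite l00 eqxx in l0.
    have := H (- lam); rewrite oppr_gt0 ln oppr_eq0 l0 normrN pil => /(_ isT isT isT).
    rewrite (_ : \sum_j _ = \sum_j (2 * sin (lam * al j / 2) / (lam * al j)) ^+ 2 * P j);
      last first.
      by apply: eq_bigr => j _; rewrite !mulNr sinN invrN mulrN mulrN mulNr opprK.
    rewrite [X in _ <= X -> _](_ : _ = \sum_j P j * (1 - sin (lam * al j) / (lam * al j)))//.
    by apply: eq_bigr => j _; rewrite !mulNr sinN invrN mulrN mulNr opprK.
  exact: H.
move=> l0; rewrite (gtr0_norm lam0) => pil; rewrite mulr_sumr; apply: ler_sum => j _.
have /andP[h1 h2] := alb j.
have al0 : 0 < al j := lt_le_trans a10 h1.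
have K := area_inequality a10 h1 h2 lam0 pil.
have th0 : lam * al j != 0 by rewrite mulf_neq0// gt_eqF.
have sq : (2 * sin (lam * al j / 2) / (lam * al j)) ^+ 2 =
    2 * (1 - cos (lam * al j)) / (lam * al j) ^+ 2.
  by rewrite one_minus_cos; field; rewrite l0 gt_eqF.
rewrite sq -subr_ge0.
have -> : P j * (1 - sin (lam * al j) / (lam * al j)) - 2 * lam * area_constant a1 ak *
    (2 * (1 - cos (lam * al j)) / (lam * al j) ^+ 2 * P j) =
    P j * lam / (lam * al j) ^+ 2 * (al j * (lam * al j - sin (lam * al j)) -
      4 * area_constant a1 ak * (1 - cos (lam * al j))).
  by field; rewrite l0 gt_eqF.
rewrite mulr_ge0 ?subr_ge0// divr_ge0 ?sqr_ge0// mulr_ge0 ?P0// ltW//.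
Qed.

Lemma sin_half_neq0 (th : R) : th != 0 -> `|th| <= pi -> sin (th / 2) != 0.
Proof.
move=> th0 thpi.
have pos t : 0 < t -> t <= pi -> 0 < sin (t / 2 : R).
  move=> t0 tpi; apply: sin_gt0_pi; have := pi_gt0 R => p0; apply/andP; split; lra.
case: (ltgtP th 0) => [tn|tp|t0]; last by rewrite t0 eqxx in th0.
  rewrite ltr0_norm// in thpi.
  by have := pos (- th); rewrite oppr_gt0 mulNr sinN oppr_gt0 => /(_ tn thpi)/lt_eqF ->.
by rewrite gtr0_norm// in thpi; rewrite gt_eqF// pos.
Qed.

End AreaBounds.

(** * The end height as a function of the multiplier *)

Section TotalArea.
Context {R : realType} {J : finType}.
Variables (al Q : J -> R) (a1 ak : R).
Hypothesis a10 : 0 < a1.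
Hypothesis alb : forall j, a1 <= al j <= ak.
Hypothesis Q0 : forall j, 0 <= Q j.
Hypothesis Qpos : 0 < \sum_j Q j.

Definition total_area (lam : R) := \sum_j al j * Q j * arc_ratio (lam * al j).

Let al0 j : 0 < al j.
Proof. by have /andP[h _] := alb j; exact: lt_le_trans h. Qed.

Let ex_Q : exists j, 0 < Q j.
Proof.
apply: contrapT => H; move: Qpos; rewrite big1 ?ltxx// => j _.
apply/eqP; rewrite eq_le Q0 andbT leNgt; apply/negP => Qj; apply: H; by exists j.
Qed.

Let ak0 : 0 < ak.
Proof.
by have [j _] := ex_Q; have /andP[h1 h2] := alb j; rewrite (lt_le_trans a10)// (le_trans h1).
Qed.

Let bound lam j : `|lam| * ak <= pi -> - pi <= lam * al j <= pi.
Proof.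
move=> h; rewrite -ler_norml normrM (gtr0_norm (al0 j)) (le_trans _ h)//.
by rewrite ler_wpM2l//; case/andP: (alb j).
Qed.

Lemma total_area_lt lam nu : `|lam| * ak <= pi -> `|nu| * ak <= pi -> lam < nu ->
  total_area lam < total_area nu.
Proof.
move=> hl hn ln; have arc j : arc_ratio (lam * al j) < arc_ratio (nu * al j).
  have /andP[h1 _] := bound j hl; have /andP[_ h2] := bound j hn.
  by rewrite arc_ratio_lt// ltr_pM2r.
have [j Qj] := ex_Q; rewrite /total_area (bigD1 j)//= [ltRHS](bigD1 j)//=.
apply: ltr_leD; first by rewrite ltr_pM2l// mulr_gt0.
by apply: ler_sum => i _; rewrite ler_wpM2l// ?mulr_ge0// ?ltW.
Qed.

Lemma total_area_inj lam nu : `|lam| * ak <= pi -> `|nu| * ak <= pi ->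
  total_area lam = total_area nu -> lam = nu.
Proof.
move=> hl hn E; case: (ltgtP lam nu) => // h.
  by have := total_area_lt hl hn h; rewrite E ltxx.
by have := total_area_lt hn hl h; rewrite E ltxx.
Qed.

Lemma total_areaN lam : total_area (- lam) = - total_area lam.
Proof.
by rewrite -sumrN; apply: eq_bigr => j _; rewrite mulNr arc_ratioN mulrN.
Qed.

Lemma total_area0 : total_area 0 = 0.
Proof. by rewrite /total_area big1// => j _; rewrite mul0r arc_ratio0 mulr0. Qed.

Lemma total_area_surj Z : `|Z| < area_constant a1 ak * \sum_j Q j ->
  exists2 lam, `|lam| * ak <= pi & total_area lam = Z.
Proof.
have pi0 := pi_gt0 R.
wlog Z0 : Z / 0 < Z.
  move=> H hZ; case: (ltgtP Z 0) => [Zn|Zp|->].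
  - have [||lam hl E] := H (- Z); rewrite ?oppr_gt0 ?normrN//.
    by exists (- lam); rewrite ?normrN// total_areaN E opprK.
  - exact: H.
  - by exists 0; rewrite ?normr0 ?mul0r ?ltW// total_area0.
rewrite gtr0_norm// => ZB.
(* The largest multiplier for which all angles [lam alpha_j] stay within [pi]. *)
pose L := pi / ak.
have L0 : 0 < L by rewrite divr_gt0.
have Lak : L * ak = pi by rewrite /L mulfVK// gt_eqF.
have range t : 0 < t -> t <= L -> forall j, 0 < t * al j <= pi.
  move=> t0 tL j; rewrite mulr_gt0//= -Lak; have /andP[_ h] := alb j.
  by rewrite ler_pM// ltW.
have ZL : Z <= total_area L.
  apply: (le_trans (ltW ZB)); rewrite mulr_sumr; apply: ler_sum => j _.
  have /andP[h1 h2] := alb j.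
  have piL : pi <= L * ak by rewrite Lak.
  have K := area_inequality a10 h1 h2 L0 piL.
  have c0 := one_minus_cos_gt0 (range L L0 (lexx L) j).
  rewrite [leRHS]mulrAC ler_wpM2r// /arc_ratio mulrA ler_pdivlMr ?mulr_gt0//.
  by rewrite mulrA (mulrC _ 4).
pose C := \sum_j al j * Q j * (al j / 4).
have C0 : 0 <= C by apply: sumr_ge0 => j _; rewrite !mulr_ge0// ltW// divr_gt0.
(* The derivative of [arc_ratio] is available only at positive angles, so the intermediate value
   theorem starts at a small [e > 0]; the linear bound [total_area e <= e C] puts its height below
   [Z]. *)
pose e := Num.min L (Z / (C + 1)).
have C1 : 0 < C + 1 by rewrite ltr_wpDl.
have e0 : 0 < e by rewrite lt_min L0 divr_gt0.
have eL : e <= L by rewrite ge_min lexx.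
have eZ : total_area e <= Z.
  apply: (@le_trans _ _ (e * C)).
    rewrite /C mulr_sumr; apply: ler_sum => j _; rewrite [leRHS]mulrCA ler_wpM2l//.
      by rewrite mulr_ge0// ltW.
    by rewrite mulrA arc_ratio_le// range.
  apply: (@le_trans _ _ (e * (C + 1))); first by rewrite ler_wpM2l ?(ltW e0)// lerDl.
  by rewrite -ler_pdivlMr// ge_min lexx orbT.
have cont : {within `[e, L], continuous total_area}.
  apply: derivable_within_continuous => t; rewrite in_itv/= => /andP[et tL].
  have t0 := lt_le_trans e0 et.
  have d j : is_derive t 1 (fun t => al j * Q j * arc_ratio (t * al j)) _ :=
    is_derive_scale (al j * Q j) (@is_derive1_comp _ arc_ratio (fun t => t * al j) t _ _
      (is_derive_arc_ratio (range t t0 tL j))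
      (is_derive_mul (is_derive_id t 1) (is_derive_cst (al j) t 1))).
  by have [] := is_derive_bigsum d.
have [|lam] := IVT eL cont (_ : Num.min (total_area e) (total_area L) <= Z <=
    Num.max (total_area e) (total_area L)).
  by rewrite ge_min eZ/= le_max ZL orbT.
rewrite in_itv/= => /andP[el lL] <-; exists lam => //.
by rewrite gtr0_norm ?(lt_le_trans e0 el)// -Lak ler_pM2r.
Qed.

End TotalArea.

(** * Existence and uniqueness of the geodesic *)

Theorem proposition3 (R : realType) (n : nat) (G : contactCarnot R n)
    (k : nat) (alpha : 'I_k.+1 -> R)
    (alpha_incr : forall i j : 'I_k.+1, (i < j)%N -> alpha i < alpha j)
    (alphaP : forall s : R,
       singular_value (cc_A G) s <-> exists i : 'I_k.+1, s = alpha i)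
    (x : 'rV[R]_(2 * n)) (z : R)
    (hz : `|z| < pi / 8 *
       (2 * alpha ord0 ^+ 2 / alpha ord_max - alpha ord_max) *
       (\sum_i x 0 i ^+ 2)) :
  exists gamma : R -> G,
    [/\ geodesic gamma, gamma 0 = ecoords 0 0, gamma 1 = ecoords x z
      & forall eta : R -> G,
          geodesic eta -> eta 0 = ecoords 0 0 -> eta 1 = ecoords x z ->
          forall t : R, 0 <= t <= 1 -> eta t = gamma t].
Proof.
have al_inj : injective alpha.
  move=> i j E; apply/val_inj; case: (ltngtP i j) => // /alpha_incr; by rewrite E ltxx.
have al_gt0 j : 0 < alpha j.
  have [al0 /eigenvalueP[v vE v0]] := (alphaP (alpha j)).2 (ex_intro _ j erefl).
  rewrite lt_neqAle al0 andbT; apply/eqP => a0; move: v0.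
  (* A singular value [0] would give a nonzero kernel vector of this invertible matrix. *)
  have AA : (cc_A G)^T *m cc_A G \in unitmx by rewrite unitmx_mul unitmx_tr cc_A_unit.
  by rewrite -(mulmxK AA v) vE -a0 expr0n scale0r mul0mx eqxx.
have alb j : alpha ord0 <= alpha j <= alpha ord_max.
  apply/andP; split.
    have [->//|j0] := eqVneq j ord0; apply/ltW/alpha_incr.
    by rewrite lt0n; apply: contra j0 => /eqP j0; apply/eqP/val_inj.
  have [->//|jm] := eqVneq j ord_max; apply/ltW/alpha_incr.
  by rewrite ltn_neqAle -ltnS ltn_ord andbT; apply: contra jm => /eqP jm; apply/eqP/val_inj.
have al_sv (s : R) : singular_value (cc_A G) s -> exists j, s = alpha j by move/alphaP.
have [xs [xE hxs]] := spectral_decomposition al_sv x.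
have {}hxs : eigen_family (G := G) alpha xs by exact: hxs.
pose Q j := dotp (xs j) (xs j).
have Q0 j : 0 <= Q j by exact: dotp_ge0.
have sum1 : \sum_j xs j = \sum_j 1 *: xs j by apply: eq_bigr => j _; rewrite scale1r.
have xx : dotp x x = \sum_j Q j.
  rewrite {1 2}xE {1 2}sum1 (@eigen_dotp_sum _ _ G _ _ al_gt0 al_inj)//.
  by apply: eq_bigr => j _; rewrite !mul1r.
have {hz} zB : `|z| < area_constant (alpha ord0) (alpha ord_max) * \sum_j Q j.
  by rewrite -xx; move: hz; under eq_bigr do rewrite expr2.
have x0 : x != 0.
  apply/eqP => x0; move: zB; rewrite -xx x0 dotp0l mulr0.
  by rewrite ltNge normr_ge0.
have Qpos : 0 < \sum_j Q j by rewrite -xx dotp_gt0.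
(* The velocity at time 1/2 recovered from the end point: the inverse of the coefficients of
   [chord], which do not vanish for nonzero [lam] while the angles stay within [pi]. *)
pose vs lam j := (lam * alpha j / (2 * sin (lam * alpha j / 2))) *: xs j.
have hvs lam : eigen_family (G := G) alpha (vs lam) by exact: eigen_familyZ.
have th_neq0 lam j : lam != 0 -> lam * alpha j != 0.
  by move=> l0; rewrite mulf_neq0// gt_eqF.
have s_neq0 lam j : lam != 0 -> `|lam| * alpha ord_max <= pi ->
    sin (lam * alpha j / 2) != 0.
  move=> l0 hl; apply: sin_half_neq0; first exact: th_neq0.
  rewrite normrM (gtr0_norm (al_gt0 j)) (le_trans _ hl)// ler_wpM2l//.
  by case/andP: (alb j).
have vs_chord lam : lam != 0 -> `|lam| * alpha ord_max <= pi ->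
    chord alpha (vs lam) lam = x.
  move=> l0 hl; rewrite xE; apply: eq_bigr => j _; rewrite scalerA.
  rewrite (_ : _ * _ = 1) ?scale1r//; field.
  by rewrite s_neq0// l0 gt_eqF.
have vs_energy lam : lam != 0 -> `|lam| * alpha ord_max <= pi ->
    \sum_j dotp (vs lam j) (vs lam j) *
      (1 - sin (lam * alpha j) / (lam * alpha j)) = 2 * lam * total_area alpha Q lam.
  move=> l0 hl; rewrite mulr_sumr; apply: eq_bigr => j _.
  rewrite /vs dotpZl dotpZr -/(Q j) /arc_ratio one_minus_cos; field.
  by rewrite s_neq0// l0 gt_eqF.
pose curve lam t : G := if lam == 0 then ecoords (t *: x) 0
  else ecoords (curve_x (G := G) alpha (vs lam) lam t) (curve_z (G := G) alpha (vs lam) lam t).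
have unique eta : geodesic eta -> eta 0 = ecoords 0 0 -> eta 1 = ecoords x z ->
    exists lam, [/\ `|lam| * alpha ord_max <= pi, total_area alpha Q lam = z
      & forall t, 0 <= t <= 1 -> eta t = curve lam t].
  move=> geo e0 e1.
  have [lam [ws [hws]]] := geodesic_data al_gt0 al_inj al_sv geo e0 e1.
  have [_|l0] := eqVneq lam 0.
    move=> [z0 etaE]; exists 0; rewrite normr0 mul0r total_area0 z0; split => //.
      by rewrite ltW// pi_gt0.
    by move=> t /etaE ->; rewrite /curve eqxx.
  move=> [xch zen etaE]; exists lam.
  (* Otherwise [energy_chord_inequality] bounds [lam z] below by [|lam|] times the bound of the
     statement, against the hypothesis on [z]. *)
  have hl : `|lam| * alpha ord_max <= pi.
    rewrite leNgt; apply/negP => /ltW hl.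
    have := energy_chord_inequality (al_gt0 ord0) alb
      (fun j => dotp_ge0 (ws j)) l0 hl.
    rewrite -zen.
    rewrite (_ : \sum_j (2 * sin _ / _) ^+ 2 * _ = \sum_j Q j); last first.
      rewrite -xx {1 2}xch /chord (@eigen_dotp_sum _ _ G _ _ al_gt0 al_inj)//.
    move=> H.
    have l1 : 0 < `|lam| by rewrite normr_gt0.
    have h1 : lam * z <= `|lam| * `|z| by rewrite -normrM ler_norm.
    have h2 : `|lam| * `|z| < `|lam| * (area_constant (alpha ord0) (alpha ord_max) *
      \sum_j Q j) by rewrite ltr_pM2l.
    move: H h2; move: (area_constant _ _) (\sum_j Q j) => B S H h2.
    move: H; rewrite -!mulrA ler_pM2l ?ltr0n// => H.
    by have := lt_le_trans (le_lt_trans h1 h2) H; rewrite ltxx.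
  (* Two decompositions of [x] along the eigenspaces coincide componentwise, so the velocity
     components of the geodesic are determined by [x] and [lam]. *)
  have wsE : ws = vs lam.
    apply/funext => j; rewrite /vs.
    have E := eigen_sum_inj al_gt0 al_inj (eigen_familyZ
      (fun j => 2 * sin (lam * alpha j / 2) / (lam * alpha j)) hws) hxs
      (etrans (esym xch) xE) j.
    rewrite -E scalerA (_ : _ * _ = 1) ?scale1r//; field.
    by rewrite s_neq0// l0 gt_eqF.
  split => //.
    apply: (@mulfI _ (2 * lam)); first by rewrite mulf_neq0// pnatr_eq0.
    by rewrite -vs_energy// zen wsE.
  by move=> t /etaE ->; rewrite /curve (negbTE l0) wsE.
have [lam hl lz] := total_area_surj (al_gt0 ord0) alb Q0 Qpos zB.
exists (curve lam).
have main : [/\ geodesic (curve lam), curve lam 0 = ecoords 0 0 & curve lam 1 = ecoords x z].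
  rewrite /curve; have [l0|l0] := eqVneq lam 0.
    rewrite scale0r scale1r -lz l0 total_area0; split => //.
    have momE t : momentum (G := G) 0 x (fun t => t *: x) t = x.
      by rewrite /momentum scale0r addr0.
    apply: (@smooth_extremal_geodesic _ _ G 0 x (fun t => t *: x) (fun=> 0)).
    - move=> t i; rewrite momE.
      have := is_derive_mul (is_derive_id t 1) (is_derive_cst (x 0 i) t 1).
      rewrite mulr0 addr0 mul1r (_ : (fun s => _ * _) = (fun s => (s *: x) 0 i))//.
      by apply/funext => s; rewrite mxE.
    - move=> t; rewrite momE -scalemxAl dotpZl area_diag !mulr0.
      exact: is_derive_cst.
    - by rewrite scale1r scale0r.
  have chx := vs_chord lam l0 hl.
  have [|geo c0 z0 c1 z1] := flow_geodesic al_gt0 al_inj (hvs lam) l0.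
  - by rewrite chx.
  rewrite c0 z0 c1 chx; split => //; congr ecoords.
  apply: (@mulfI _ (2 * lam)); first by rewrite mulf_neq0// pnatr_eq0.
  by rewrite z1 vs_energy// lz.
have [geo c0 c1] := main; split => // eta geo' e0 e1 t tab.
have [nu [hn nz ->//]] := unique eta geo' e0 e1.
(* Both multipliers lie in the range where the height is strictly increasing and give the same
   height [z], so they are equal. *)
by rewrite (total_area_inj (al_gt0 ord0) alb Q0 Qpos hn hl _)// nz lz.
Qed.
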